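(* Let $\alpha\in(0,2)$, $\mu_n(x)=\dfrac{(ix-1)^n}{(ix+1)^{n+1}}$ for $n\in\mathbb Z$, and, for $n=0,1,2,\ldots$ and $x\in\mathbb R$, $$\mathrm{CC}_{2n}(x)=\frac{\mu_n(x)-\mu_{-n-1}(x)}{2},\qquad \mathrm{SC}_{2n+1}(x)=-\frac{\mu_n(x)+\mu_{-n-1}(x)}{2i}.$$ Then, for every $n=0,1,2,\ldots$ and every $x\in\mathbb R$, $$ \begin{aligned} (-\Delta)^{\alpha/2}\mathrm{CC}_{2n}(x)={}&\frac{\Gamma(1+\alpha)}{(1+x^2)^{(n+1+\alpha)/2}}\sin\left((n+1+\alpha)\,\mathrm{arccot}(x)-\frac{\pi\alpha}{2}\right)\\ &\quad\times\sum_{l=0}^{\lfloor\frac{n}{2}\rfloor}(-1)^l\binom{n}{2l}x^{n-2l}\,{}_2F_1(-2l,1+\alpha;1;2)\\ &-\frac{\Gamma(1+\alpha)}{(1+x^2)^{(n+1+\alpha)/2}}\cos\left((n+1+\alpha)\,\mathrm{arccot}(x)-\frac{\pi\alpha}{2}\right)\\ &\quad\times\sum_{l=0}^{\lfloor\frac{n-1}{2}\rfloor}(-1)^l\binom{n}{2l+1}x^{n-2l-1}\,{}_2F_1(-2l-1,1+\alpha;1;2), \end{aligned} $$ and $$ \begin{aligned} (-\Delta)^{\alpha/2}\mathrm{SC}_{2n+1}(x)={}&\frac{\Gamma(1+\alpha)}{(1+x^2)^{(n+1+\alpha)/2}}\cos\left((n+1+\alpha)\,\mathrm{arccot}(x)-\frac{\pi\alpha}{2}\right)\\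 &\quad\times\sum_{l=0}^{\lfloor\frac{n}{2}\rfloor}(-1)^l\binom{n}{2l}x^{n-2l}\,{}_2F_1(-2l,1+\alpha;1;2)\\ &+\frac{\Gamma(1+\alpha)}{(1+x^2)^{(n+1+\alpha)/2}}\sin\left((n+1+\alpha)\,\mathrm{arccot}(x)-\frac{\pi\alpha}{2}\right)\\ &\quad\times\sum_{l=0}^{\lfloor\frac{n-1}{2}\rfloor}(-1)^l\binom{n}{2l+1}x^{n-2l-1}\,{}_2F_1(-2l-1,1+\alpha;1;2). \end{aligned} $$
   Context: For $\alpha\in(0,2)$ the one-dimensional fractional Laplacian of a (possibly complex-valued) function $u$ on $\mathbb R$ is $$(-\Delta)^{\alpha/2}u(x)=c_\alpha\int_{-\infty}^\infty\frac{u(x)-u(x+y)}{|y|^{1+\alpha}}\,dy,\qquad c_\alpha=\alpha\,\frac{2^{\alpha-1}\Gamma(1/2+\alpha/2)}{\sqrt\pi\,\Gamma(1-\alpha/2)},$$ the integral being understood in the principal value sense at $y=0$; equivalently, for the functions considered here, $(-\Delta)^{\alpha/2}u(x)=\frac{c_\alpha}{\alpha}\int_0^\infty\frac{u'(x-y)-u'(x+y)}{y^\alpha}\,dy$. The function $\mathrm{arccot}$ takes values in $[0,\pi]$: for $x\in\mathbb R$, $\mathrm{arccot}(x)$ is the unique $s\in(0,\pi)$ with $\cot(s)=x$. The convention $x^0=1$ is used, also at $x=0$. A sum whose upper limit is $-1$ is empty and equals $0$. The Gaussian hypergeometric function is ${}_2F_1(a,b;c;z)=\sum_{k=0}^\infty\frac{(a)_k(b)_k}{(c)_k}\frac{z^k}{k!}$,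 where $(w)_0=1$ and $(w)_k=w(w+1)\cdots(w+k-1)$ for $k\ge1$. When $a$ is a nonpositive integer the sum is finite (terms with $k>-a$ vanish), and it is then defined by this finite sum for all $z\in\mathbb C$. *)

(* Defs.v *)
From HB Require Import structures.
From mathcomp Require Import all_boot all_order all_algebra.
From mathcomp Require Import complex.
From mathcomp Require Import all_classical all_reals all_analysis.

Set Implicit Arguments.
Unset Strict Implicit.
Unset Printing Implicit Defensive.

Import Order.TTheory GRing.Theory Num.Theory.
Import numFieldNormedType.Exports.

Local Open Scope classical_set_scope.
Local Open Scope complex_scope.
Local Open Scope ring_scope.

(* Euler's integral; meaningful for [0 < z], the only case needed. *)
Definition Gamma (R : realType) (z : R) : R :=
  \int[@lebesgue_measure R]_(t in `]0, +oo[) (t `^ (z - 1) * expR (- t)).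

Definition arccot (R : realType) (x : R) : R :=
  get [set s : R | 0 < s < pi /\ cos s / sin s = x].

Definition pochhammer (R : realType) (w : R) (k : nat) : R :=
  \prod_(i < k) (w + i%:R).

Definition hyp2F1_term (R : realType) (a b c z : R) (k : nat) : R :=
  pochhammer a k * pochhammer b k / pochhammer c k * (z ^+ k / k`!%:R).

(* When [a] is a nonpositive integer the partial sums are eventually constant,
   so the limit is the finite sum, for every [z] (see [hyp2F1_Nnat]). *)
Definition hyp2F1 (R : realType) (a b c z : R) : R :=
  limn (series (hyp2F1_term a b c z)).

Definition fraclap_const (R : realType) (alpha : R) : R :=
  alpha * (2 `^ (alpha - 1) * Gamma (1 / 2 + alpha / 2)
           / (Num.sqrt pi * Gamma (1 - alpha / 2))).

Definition fraclap_integrand (R : realType) (alpha : R) (u : R -> R) (x y : R)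
    : R :=
  (u x - u (x + y)) / `|y| `^ (1 + alpha).

(* [v] is the value at [x] of the fractional Laplacian of [u]: the truncated
   integrals exist as Lebesgue integrals and converge, as the symmetric
   truncation around [y = 0] shrinks, to a limit which gives [v] after
   multiplication by the constant. *)
Definition is_fraclap_real (R : realType) (alpha : R) (u : R -> R) (x v : R)
    : Prop :=
  (forall eps : R, 0 < eps ->
     (@lebesgue_measure R).-integrable [set y | eps < `|y|]
       (EFin \o fraclap_integrand alpha u x))
  /\ fraclap_const alpha
       * (\int[@lebesgue_measure R]_(y in [set y | eps < `|y|])
            fraclap_integrand alpha u x y) @[eps --> 0^'+] --> v.

(* The integral of a complex-valued function is taken componentwise. *)
Definition is_fraclap (R : realType) (alpha : R) (u : R -> R[i]) (x : R)
    (v : R[i]) : Prop :=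
  is_fraclap_real alpha (fun t => complex.Re (u t)) x (complex.Re v)
  /\ is_fraclap_real alpha (fun t => complex.Im (u t)) x (complex.Im v).

Definition mu_ (R : realType) (n : int) (x : R) : R[i] :=
  ('i%C * x%:C - 1) ^ n / ('i%C * x%:C + 1) ^ (n + 1).

(* [CC_even n] is $\mathrm{CC}_{2n}$ and [SC_odd n] is $\mathrm{SC}_{2n+1}$. *)
Definition CC_even (R : realType) (n : nat) (x : R) : R[i] :=
  (mu_ n%:Z x - mu_ (- n%:Z - 1) x) / 2.

Definition SC_odd (R : realType) (n : nat) (x : R) : R[i] :=
  - ((mu_ n%:Z x + mu_ (- n%:Z - 1) x) / (2 * 'i%C)).

Lemma arccotE (R : realType) (x : R) : arccot x = pi / 2 - atan x.
Proof.
have trigE t : cos (pi / 2 - t) = sin t /\ sin (pi / 2 - t) = cos t :> R.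
  by rewrite cosB sinB cos_pihalf sin_pihalf !mul0r !mul1r add0r subr0.
rewrite /arccot; apply: get_unique.
  split.
    have := atan_gtNpi2 x; have := atan_ltpi2 x => h1 h2.
    rewrite subr_gt0 h1 /= ltrBlDr -ltrBlDl.
    by have -> : pi / 2 - pi = - (pi / 2) :> R by rewrite {2}(splitr pi) opprD addNKr ?addrA ?subrr ?sub0r.
  by have [-> ->] := trigE (atan x); rewrite -/(tan (atan x)) atanK.
move=> s /= [/andP[s0 spi] <-].
have [cE sE] := trigE (pi / 2 - s); rewrite opprB addrC subrK in cE sE.
rewrite cE sE -/(tan (pi / 2 - s)) tanK ?opprB; first by rewrite addrC subrK.
rewrite in_itv /= ltrBlDl ltrDr s0 andbT.
by rewrite ltrBrDl -ltrBrDr opprK -splitr.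
Qed.

Lemma hyp2F1_Nnat (R : realType) (m : nat) (b c z : R) :
  hyp2F1 (- m%:R) b c z = \sum_(k < m.+1) hyp2F1_term (- m%:R) b c z k.
Proof.
rewrite /hyp2F1; apply/cvg_lim => //; apply: cvg_near_cst.
exists m.+1 => // N /= mN; rewrite /series /=.
rewrite (big_cat_nat (leq0n _) mN) /= big_mkord.
rewrite [X in _ + X]big_nat [X in _ + X]big1 ?addr0// => k /andP[mk _].
by rewrite /hyp2F1_term /pochhammer (bigD1 (Ordinal mk)) //= addNr !mul0r.
Qed.

(* Main.v *)
(* Since [mu_(-n-1) = - conj mu_n], one has [CC_2n = Re mu_n] and
   [SC_(2n+1) = - Im mu_n].  Expanding [(ix - 1) ^ n = ((ix + 1) - 2) ^ n],
   [mu_n] is a combination of the functions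
   [(1 + ix) ^ (- a) = Gamma (a) ^ (-1) int_0^oo s ^ (a - 1) e ^ (- s) e ^ (- ixs) ds].
   On a superposition of cosines [int_0^oo w s * cos (x s - th) ds], the
   fractional Laplacian multiplies [w] by [s ^ alpha]: by Fubini this amounts to
   [int_0^oo 2 (1 - cos (s y)) / y ^ (1 + alpha) dy = s ^ alpha / c_alpha], and the
   constant is found by integrating this kernel against [e ^ (- s ^ 2)].  Hence
   [(1 + ix) ^ (- a)] is mapped to
   [Gamma (a + alpha) / Gamma (a) * (1 + ix) ^ (- a - alpha)], and what remains is
   a rearrangement of finite sums. *)
Require Import Defs.
From HB Require Import structures.
From mathcomp Require Import all_boot all_order all_algebra.
From mathcomp Require Import complex ring lra.
From mathcomp Require Import all_classical all_reals all_analysis measurable_realfun.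

Set Implicit Arguments.
Unset Strict Implicit.
Unset Printing Implicit Defensive.

Import Order.TTheory GRing.Theory Num.Theory.
Import numFieldNormedType.Exports.

Local Open Scope classical_set_scope.
Local Open Scope complex_scope.
Local Open Scope ring_scope.

(** * Integrals over the positive half-line *)

(** Everything analytic is done with real integrals. The phase [th] of the cosine integrals carries
    both the real part ([th = 0]) and the negated imaginary part ([th = pi / 2]) of the Fourier-type
    integral, and shifting it by [pi / 2] replaces multiplication by i. The obstacle is the
    principal value. Adding the contributions of y and -y turns the difference quotient into the
    second difference 2 cos A - cos (A + sy) - cos (A - sy) = 2 cos A (1 - cos (sy)), which is
    O(y^2) and hence absolutely integrable against y^(-1 - alpha) when alpha < 2. Fubini then
    applies, and the truncated integrals converge because the folded integrand is integrable. The
    values of 2F1 at 2 arise when the powers of 1 + ix left after factoring out (1 + ix)^(-(n + 1 +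
    alpha)) are re-expanded in powers of ix: the coefficient of each power is a binomial transform
    of (-2)^k (1 + alpha)_k / (1)_k. The trigonometric factors come from arccot x = pi / 2 - atan x,
    which brings out a power of -i that cancels the powers of i in (ix)^(n - j). *)

Section positive_half_line.
Context {R : realType}.
Local Notation mu := (@lebesgue_measure R).
Local Notation P := (`]0, +oo[%classic : set R).

(** A compact exhaustion of the half-line, on which the classical theorems of calculus apply before
    passing to the limit. [I_ 0] is the single point 1, so the lemmas below work with [I_ n.+1],
    whose endpoints are distinct. *)
Let I_ (n : nat) : set R := `[n.+1%:R^-1, n.+1%:R]%classic.

Let bigcupI : \bigcup_n I_ n = P.
Proof.
apply/seteqP; split => [x [n _]|x]; rewrite /I_ /= !in_itv /= ?andbT.
  by move=> /andP[+ _]; apply: lt_le_trans; rewrite invr_gt0.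
move=> x0; have xV0 : 0 < x^-1 by rewrite invr_gt0.
have := archi_boundP (ltW (addr_gt0 x0 xV0)); set n := Num.Def.archi_bound _ => xn.
exists n => //; rewrite /= in_itv/=.
have nn : n%:R <= n.+1%:R :> R by rewrite ler_nat.
apply/andP; split; last by lra.
rewrite -(invrK x) lef_pV2 ?posrE//; lra.
Qed.

Let subI n : I_ n `<=` P.
Proof. by rewrite -bigcupI; exact: bigcup_sup. Qed.

Let ndI : {homo I_ : n m / (n <= m)%N >-> (n <= m)%O}.
Proof.
move=> n m nm; apply/subsetPset => x; rewrite /I_ /= !in_itv/= => /andP[nx xn].
rewrite (le_trans _ nx) ?(le_trans xn) ?ler_nat//.
by rewrite lef_pV2 ?posrE// ler_nat.
Qed.

Let itvI (n : nat) : n.+2%:R^-1 < n.+2%:R :> R.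
Proof. by rewrite (@lt_le_trans _ _ 1) ?invf_lt1 ?ltr1n ?ler1n. Qed.

Lemma continuous_measurable_pos (f : R -> R) :
  (forall x : R, 0 < x -> {for x, continuous f}) -> measurable_fun P f.
Proof.
move=> cf; apply: open_continuous_measurable_fun => // x.
by rewrite inE/= in_itv/= andbT; exact: cf.
Qed.

Let within_continuousI (f : R -> R) (a b : R) : 0 < a ->
  (forall x : R, 0 < x -> {for x, continuous f}) -> {within `[a, b], continuous f}.
Proof.
move=> a0 cf; apply: continuous_in_subspaceT => x.
by rewrite inE/= in_itv/= => /andP[ax _]; apply: cf; exact: lt_le_trans ax.
Qed.

Let FTC2I (F f : R -> R) n : (forall x : R, 0 < x -> is_derive x 1 F (f x)) ->
  (forall x : R, 0 < x -> {for x, continuous f}) ->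
  (\int[mu]_(x in I_ n.+1) (f x)%:E = (F n.+2%:R - F n.+2%:R^-1)%:E)%E.
Proof.
move=> dF cf; rewrite EFinB.
have cF x : 0 < x -> {for x, continuous F}.
  move=> x0; apply/differentiable_continuous/derivable1_diffP.
  by have [] := dF _ x0.
have n0 : 0 < n.+2%:R^-1 :> R by rewrite invr_gt0.
apply: continuous_FTC2 => //.
- exact: within_continuousI.
- split.
  + move=> x; rewrite in_itv/= => /andP[nx _].
    by have [] := dF x (lt_trans n0 nx).
  + exact/cvg_at_right_filter/cF.
  + exact/cvg_at_left_filter/cF.
- move=> x; rewrite in_itv/= => /andP[nx _].
  by rewrite derive1E; have [_ ->] := dF x (lt_trans n0 nx).
Qed.

Let cvgFI (F : R -> R) (l L : R) :
  F x @[x --> 0^'+] --> l -> F x @[x --> +oo] --> L ->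
  F n.+2%:R - F n.+2%:R^-1 @[n --> \oo] --> L - l.
Proof.
move=> Fl FL; apply: cvgB.
  have /cvg_pinftyP/(_ (fun n => n.+2%:R)) := FL; apply.
  by rewrite (_ : (fun _ => _) = (fun n => (n + 2)%:R)) ?cvg_shiftn;
    [exact: cvgr_idn|apply/funext => n; rewrite addn2].
move/cvg_at_rightP : Fl; apply; split => [n|]; first by rewrite invr_gt0.
have := @cvg_harmonic R; rewrite -(cvg_shiftn 1)/=.
by under eq_fun do rewrite addn1.
Qed.

Lemma ge0_FTC2_0y (F f : R -> R) (l L : R) :
  (forall x : R, 0 < x -> is_derive x 1 F (f x)) ->
  (forall x : R, 0 < x -> {for x, continuous f}) ->
  (forall x : R, 0 < x -> 0 <= f x) ->
  F x @[x --> 0^'+] --> l -> F x @[x --> +oo] --> L ->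
  (\int[mu]_(x in P) (f x)%:E = (L - l)%:E)%E.
Proof.
move=> dF cf f0 Fl FL.
have mf : measurable_fun P (EFin \o f).
  by apply/measurable_EFinP; exact: continuous_measurable_pos.
have h : (\int[mu]_(x in I_ n) (f x)%:E)%E @[n --> \oo] --> (L - l)%:E.
  rewrite -(cvg_shiftn 1)/=; under eq_fun do rewrite addn1 (FTC2I _ dF cf).
  by apply: cvg_EFin; [exact: nearW|exact: cvgFI].
apply: (cvg_unique (@ereal_hausdorff R) _ h); rewrite -bigcupI.
apply: (@ge0_nondecreasing_set_cvg_integral _ (measurableTypeR R)).
- exact: ndI.
- by move=> i; exact: measurable_itv.
- by move=> i; exact: measurable_funS mf.
- move=> i x Ix; rewrite /= lee_fin f0//.
  by have := @subI i x Ix; rewrite /= in_itv/= andbT.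
Qed.

Lemma eq_integral_pos (f g : R -> \bar R) :
  (forall x : R, 0 < x -> f x = g x) ->
  (\int[mu]_(x in P) f x = \int[mu]_(x in P) g x)%E.
Proof.
move=> fg; apply: eq_integral => x; rewrite inE/= in_itv/= andbT; exact: fg.
Qed.

Lemma ge0_integrable_0y (f : R -> R) : measurable_fun P f ->
  (forall x : R, 0 < x -> 0 <= f x) ->
  (\int[mu]_(x in P) (f x)%:E < +oo)%E -> mu.-integrable P (EFin \o f).
Proof.
move=> mf f0 fy; apply/integrableP; split; first exact/measurable_EFinP.
rewrite (@eq_integral_pos _ (EFin \o f))//= => x x0.
by rewrite ger0_norm// f0.
Qed.

(** For a signed [f], dominated convergence with [|f|] as bound replaces monotone convergence.
    Integrability has to be known beforehand; the nonnegative version above serves to establish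
    it. *)
Lemma FTC2_0y (F f : R -> R) (l L : R) :
  (forall x : R, 0 < x -> is_derive x 1 F (f x)) ->
  (forall x : R, 0 < x -> {for x, continuous f}) ->
  mu.-integrable P (EFin \o f) ->
  F x @[x --> 0^'+] --> l -> F x @[x --> +oo] --> L ->
  \int[mu]_(x in P) f x = L - l.
Proof.
move=> dF cf intf Fl FL; rewrite /Rintegral.
suff -> : (\int[mu]_(x in P) (f x)%:E = (L - l)%:E)%E by [].
have mf : measurable_fun P (EFin \o f).
  by apply/measurable_EFinP; exact: continuous_measurable_pos.
have h : (\int[mu]_(x in P) ((EFin \o f) \_ (I_ n)) x)%E @[n --> \oo]
    --> (L - l)%:E.
  rewrite -(cvg_shiftn 1)/=.
  rewrite (_ : (fun _ => _) = (fun n => (F n.+2%:R - F n.+2%:R^-1)%:E)).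
    by apply: cvg_EFin; [exact: nearW|exact: cvgFI].
  apply/funext => n; rewrite -(FTC2I _ dF cf) addn1.
  by rewrite -integral_mkcondr setIidr//; exact: subI.
apply: (cvg_unique (@ereal_hausdorff R) _ h).
apply: (@dominated_cvg _ (measurableTypeR R) _ _ _ _ _ _ (abse \o (EFin \o f))).
- exact: measurable_itv.
- move=> n; apply/measurable_restrict => //; first exact: measurable_itv.
  by apply: measurable_funS mf => // x [].
- move=> x; rewrite -{1}bigcupI => -[n _ nx].
  apply: cvg_near_cst; exists n => // m /= nm.
  rewrite patchE mem_set//.
  by have /subsetPset := ndI nm; exact.
- by [].
- exact: integrable_abse.
- move=> n x _; rewrite patchE; case: ifPn => // _; rewrite abse0.
  exact: abse_ge0.
Qed.

(** Since [F] maps the half-line onto itself, the images [J n] of the intervals [I_ n] exhaust it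
    too. The substitution is made on each compact interval and monotone convergence is applied on
    both sides. *)
Lemma ge0_integration_by_substitution_0y (F f G : R -> R) :
  (forall x : R, is_derive x 1 F (f x)) -> continuous f ->
  {in P &, {homo F : x y / x < y}} ->
  (forall x : R, 0 < x -> 0 < F x) ->
  (forall y : R, 0 < y -> exists2 x, 0 < x & F x = y) ->
  (forall x : R, 0 < x -> 0 <= f x) ->
  (forall x : R, 0 < x -> {for x, continuous G}) ->
  (forall x : R, 0 < x -> 0 <= G x) ->
  (\int[mu]_(x in P) (G x)%:E = \int[mu]_(x in P) (G (F x) * f x)%:E)%E.
Proof.
move=> dF cf incF F_gt0 surjF f0 cG G0.
have F'E : F^`()%classic = f.
  by apply/funext => x; rewrite derive1E; have [_ ->] := dF x.
have cF : continuous F.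
  move=> x; apply/differentiable_continuous/derivable1_diffP.
  by have [] := dF x.
have ndF x y : 0 < x -> x <= y -> F x <= F y.
  move=> x0; rewrite le_eqVlt => /predU1P[->//|xy]; apply/ltW/incF => //.
    by rewrite inE/= in_itv/= x0.
  by rewrite inE/= in_itv/= (lt_trans x0 xy).
pose J n : set R := `[F n.+1%:R^-1, F n.+1%:R]%classic.
have n0 n : 0 < n.+1%:R^-1 :> R by rewrite invr_gt0.
have subJ n : J n `<=` P.
  move=> x; rewrite /J/= !in_itv/= andbT => /andP[+ _]; apply: lt_le_trans.
  exact: F_gt0.
have ndJ : {homo J : n m / (n <= m)%N >-> (n <= m)%O}.
  move=> n m nm; apply/subsetPset => x; rewrite /J/= !in_itv/= => /andP[nx xn].
  rewrite (le_trans _ nx) ?(le_trans xn)// ndF// ?ler_nat//.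
  by rewrite lef_pV2 ?posrE// ler_nat.
have bigcupJ : \bigcup_n J n = P.
  apply/seteqP; split => [x [n _]|x]; first exact: subJ.
  rewrite /= in_itv/= andbT => /surjF[z z0 <-].
  have : P z by rewrite /= in_itv/= z0.
  rewrite -{1}bigcupI => -[n _]; rewrite /I_/= in_itv/= => /andP[nz zn].
  by exists n => //; rewrite /J/= in_itv/= !ndF.
have mG : measurable_fun P (EFin \o G).
  by apply/measurable_EFinP; exact: continuous_measurable_pos.
have cGF x : 0 < x -> {for x, continuous (fun x => G (F x) * f x)}.
  move=> x0; apply: cvgM; last exact: cf.
  by apply: (@continuous_comp _ _ _ F G); [exact: cF|exact/cG/F_gt0].
have mGF : measurable_fun P (fun x => (G (F x) * f x)%:E).
  by apply/measurable_EFinP; exact: continuous_measurable_pos.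
have IJ n : (\int[mu]_(x in J n.+1) (G x)%:E =
    \int[mu]_(x in I_ n.+1) (G (F x) * f x)%:E)%E.
  have := @integration_by_substitution_increasing _ F G n.+2%:R^-1 n.+2%:R.
  rewrite F'E; apply.
  - exact/ltW/itvI.
  - move=> x y; rewrite !in_itv/= => /andP[nx _] /andP[ny _].
    apply: incF; rewrite inE/= in_itv/= andbT; first exact: lt_le_trans nx.
    exact: lt_le_trans ny.
  - by move=> x _; exact: cf.
  - by apply/cvg_ex; exists (f n.+2%:R^-1); exact/cvg_at_right_filter/cf.
  - by apply/cvg_ex; exists (f n.+2%:R); exact/cvg_at_left_filter/cf.
  - split.
    + by move=> x _; have [] := dF x.
    + exact/cvg_at_right_filter/cF.
    + exact/cvg_at_left_filter/cF.
  - by apply: within_continuousI => //; exact: F_gt0.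
have hJ : (\int[mu]_(x in J n) (G x)%:E)%E @[n --> \oo] -->
    (\int[mu]_(x in P) (G x)%:E)%E.
  rewrite -bigcupJ.
  apply: (@ge0_nondecreasing_set_cvg_integral _ (measurableTypeR R)) => //.
  - by move=> i; exact: measurable_itv.
  - by move=> i; exact: measurable_funS mG.
  - by move=> i x /subJ; rewrite /= in_itv/= andbT lee_fin; exact: G0.
have hI : (\int[mu]_(x in I_ n) (G (F x) * f x)%:E)%E @[n --> \oo] -->
    (\int[mu]_(x in P) (G (F x) * f x)%:E)%E.
  rewrite -bigcupI.
  apply: (@ge0_nondecreasing_set_cvg_integral _ (measurableTypeR R)) => //.
  - by move=> i; exact: measurable_itv.
  - by move=> i; exact: measurable_funS mGF.
  - move=> i x /subI; rewrite /= in_itv/= andbT lee_fin => x0.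
    by rewrite mulr_ge0 ?f0 ?G0 ?F_gt0.
move: hJ hI; rewrite -(cvg_shiftn 1)/= => hJ; rewrite -(cvg_shiftn 1)/= => hI.
apply: (cvg_unique (@ereal_hausdorff R) hJ).
apply: cvg_trans hI; apply: near_eq_cvg; apply: nearW => n /=.
by rewrite addn1 IJ.
Qed.

Lemma ge0_integral_scale_0y (c : R) (G : R -> R) : 0 < c ->
  (forall x : R, 0 < x -> {for x, continuous G}) ->
  (forall x : R, 0 < x -> 0 <= G x) ->
  (\int[mu]_(x in P) (G x)%:E = \int[mu]_(x in P) (G (c * x) * c)%:E)%E.
Proof.
move=> c0 cG G0.
apply: (@ge0_integration_by_substitution_0y (fun x => c * x) (fun=> c) G) => //.
- by move=> x; apply: is_derive_eq; rewrite /GRing.scale/= mulr1.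
- by move=> x; exact: cvg_cst.
- by move=> x y _ _; rewrite ltr_pM2l.
- by move=> x x0; rewrite mulr_gt0.
- by move=> y y0; exists (c^-1 * y); rewrite ?mulr_gt0 ?invr_gt0// mulVKf// gt_eqF.
- by move=> x _; exact: ltW.
Qed.

Lemma ge0_integral_sqr_0y (G : R -> R) :
  (forall x : R, 0 < x -> {for x, continuous G}) ->
  (forall x : R, 0 < x -> 0 <= G x) ->
  (\int[mu]_(x in P) (G x)%:E = \int[mu]_(x in P) (G (x ^+ 2) * (2 * x))%:E)%E.
Proof.
move=> cG G0.
apply: (@ge0_integration_by_substitution_0y (fun x => x ^+ 2) (fun x => 2 * x) G) => //.
- by move=> x; apply: is_derive_eq; rewrite /GRing.scale/= ?mulr1; ring.
- by move=> x; apply: cvgM; [exact: cvg_cst|exact: cvg_id].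
- move=> x y; rewrite !inE/= !in_itv/= !andbT => x0 y0.
  by rewrite ltr_sqr ?nnegrE ?ltW.
- by move=> x x0; rewrite exprn_gt0.
- by move=> y y0; exists (Num.sqrt y); rewrite ?sqrtr_gt0// sqr_sqrtr// ltW.
- by move=> x x0; rewrite mulr_ge0// ltW.
Qed.

End positive_half_line.

(** * Powers, and integrability by comparison with powers at both ends *)

Section powers.
Context {R : realType}.
Local Notation mu := (@lebesgue_measure R).
Local Notation P := (`]0, +oo[%classic : set R).

Lemma gt0_powRD (x r s : R) : 0 < x -> x `^ (r + s) = x `^ r * x `^ s.
Proof. by move=> x0; rewrite powRD ?lt0r_neq0 ?implybT. Qed.

Lemma powRN_cvg0y (r : R) : 0 < r -> x `^ (- r) @[x --> +oo] --> 0.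
Proof.
move=> r0; apply/cvgrPdist_le => e e0; near=> x.
have x0 : 0 < x by near: x; exact: nbhs_pinfty_gt.
rewrite sub0r normrN ger0_norm ?powR_ge0// powRN invf_ple ?posrE ?powR_gt0//.
rewrite -[leLHS](@powRr1 _ e^-1) ?invr_ge0 ?(ltW e0)// -(mulVf (lt0r_neq0 r0)).
rewrite powRrM ge0_ler_powR ?nnegrE ?powR_ge0// ?(ltW r0)//.
Unshelve. all: end_near. Qed.

(** Raise e^(s/p) >= 1 + s/p >= s/p to the power [p] and invert; the constant is p^p. *)
Lemma expRN_powR_le (p : R) : 0 < p ->
  exists2 C, 0 <= C & forall s, 0 < s -> expR (- s) <= C * s `^ (- p).
Proof.
move=> p0; exists (p^-1 `^ (- p)); first exact: powR_ge0.
move=> s s0; rewrite -powRM ?invr_ge0 ?(ltW s0) ?(ltW p0)//.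
rewrite expRN powRN lef_pV2 ?posrE ?expR_gt0 ?powR_gt0 ?mulr_gt0 ?invr_gt0//.
rewrite -[in leRHS](divfK (lt0r_neq0 p0) s) expRM mulrC.
rewrite ge0_ler_powR ?nnegrE ?(ltW p0) ?expR_ge0 ?divr_ge0 ?(ltW s0) ?(ltW p0)//.
by rewrite (le_trans _ (expR_ge1Dx _))// lerDr.
Qed.

(* [r s ^ (r - 1) / (1 + s ^ r) ^ 2], the derivative of [- (1 + s ^ r) ^ -1],
   decays like a power at both ends, and so dominates [h] for [r <= p, q]. *)
Lemma integrable_0y_powR (p q A B : R) (h : R -> R) : 0 < p -> 0 < q ->
  measurable_fun P h ->
  (forall x : R, 0 < x -> x <= 1 -> `|h x| <= A * x `^ (p - 1)) ->
  (forall x, 1 < x -> `|h x| <= B * x `^ (- q - 1)) ->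
  mu.-integrable P (EFin \o h).
Proof.
move=> p0 q0 mh hA hB; pose r := Num.min p q.
have r0 : 0 < r by rewrite lt_min p0 q0.
pose g (s : R) := r * s `^ (r - 1) * (1 + s `^ r) ^- 2.
have D0 (x : R) : 0 < 1 + x `^ r by rewrite ltr_pwDl// powR_ge0.
have g0 x : 0 <= g x.
  by rewrite !mulr_ge0 ?invr_ge0 ?exprn_ge0 ?powR_ge0 ?(ltW (D0 _))// ltW.
have dF (x : R) : 0 < x -> is_derive x 1 (fun s => - (1 + s `^ r)^-1) (g x).
  move=> x0; have d1 : is_derive x 1 (fun s => 1 + s `^ r) (r * x `^ (r - 1)).
    have := is_derive1_powR r x0 => d.
    by rewrite -[X in is_derive _ _ _ X]add0r; apply: is_deriveD.
  have d2 := @is_deriveV _ (fun s : R => 1 + s `^ r) x _ 1 (lt0r_neq0 (D0 x)) d1.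
  by apply: is_derive_eq; rewrite /GRing.scale/= /g mulNr opprK mulrC.
have cpow (a x : R) : 0 < x -> {for x, continuous (fun s => s `^ a)}.
  move=> x0; apply/differentiable_continuous/derivable1_diffP.
  by have [] := is_derive1_powR a x0.
have cg (x : R) : 0 < x -> {for x, continuous g}.
  move=> x0; apply: cvgM; first by apply: cvgM; [exact: cvg_cst|exact: cpow].
  apply: cvgV; first by rewrite expf_neq0// lt0r_neq0.
  rewrite /=; under eq_fun do rewrite expr2.
  by apply: cvgM; apply: cvgD; try exact: cvg_cst; exact: cpow.
have intg : mu.-integrable P (EFin \o g).
  apply: ge0_integrable_0y => //; first exact: continuous_measurable_pos.
  rewrite (@ge0_FTC2_0y _ _ _ (- 1) 0 dF cg) ?ltry//.
    rewrite -[X in _ --> - X]invr1; apply: cvgN; apply: cvgV => //.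
    by rewrite -[X in _ --> X]addr0; apply: cvgD; [exact: cvg_cst|exact: powR_cvg0].
  rewrite -oppr0; apply: cvgN.
  apply: (@squeeze_cvgr _ _ _ _ (cst 0) (fun x => x `^ (- r))); last 2 first.
  - exact: cvg_cst.
  - exact: powRN_cvg0y.
  near=> x; have x0 : 0 < x by near: x; exact: nbhs_pinfty_gt.
  rewrite /= invr_ge0 ltW//= powRN lef_pV2 ?posrE ?powR_gt0//.
  by rewrite lerDr.
(* The 4 bounds the denominator of [g]: (1 + x^r)^2 is at most 4 for x <= 1 and at most 4 x^(2r) for
   x > 1, so [g x] is at least r/4 times x^(r - 1), respectively x^(- r - 1). The absolute values
   are there because [A] and [B] have no assumed sign. *)
pose M := (`|A| + `|B|) * (4 / r).
have ig : mu.-integrable P (fun x => M%:E * (EFin \o g) x)%E.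
  by apply: integrableZl => //; exact: measurable_itv.
apply: (le_integrable _ _ _ ig) => /=; [exact: measurable_itv|exact/measurable_EFinP|].
move=> x; rewrite in_itv/= andbT => x0; rewrite lee_fin.
rewrite [leRHS]ger0_norm; last first.
  by rewrite mulr_ge0 ?g0// mulr_ge0 ?addr_ge0// divr_ge0// ltW.
have xr0 : 0 < x `^ r by exact: powR_gt0.
have key C c : 0 <= c -> `|h x| <= C * c -> (`|C| <= `|A| + `|B|) -> c <= 4 / r * g x ->
    `|h x| <= M * g x.
  move=> c0 hC CAB cg'; rewrite (le_trans hC)// (@le_trans _ _ (`|C| * c))//.
    by rewrite ler_wpM2r// ler_norm.
  by rewrite /M -mulrA ler_pM.
have gE : 4 / r * g x = 4 * x `^ (r - 1) / (1 + x `^ r) ^+ 2.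
  by rewrite /g; field; rewrite !lt0r_neq0.
have [x1|x1] := leP x 1.
  apply: (key A _ (powR_ge0 x (p - 1)) (hA _ x0 x1)); first by rewrite lerDl.
  rewrite gE; apply: (@le_trans _ _ (x `^ (r - 1))).
    by rewrite ger_powR ?x0//= lerB// ge_min lexx.
  rewrite ler_pdivlMr ?exprn_gt0// mulrC ler_wpM2r ?powR_ge0//.
  have : x `^ r <= 1.
    by rewrite -[leRHS](powRr0 x) ger_powR ?x0// ltW.
  by nra.
apply: (key B _ (powR_ge0 x (- q - 1)) (hB _ x1)); first by rewrite lerDr.
rewrite gE; apply: (@le_trans _ _ (x `^ (- r - 1))).
  by rewrite ler_powR ?(ltW x1)// lerB// lerN2 ge_min lexx orbT.
have -> : x `^ (r - 1) = x `^ (- r - 1) * (x `^ r) ^+ 2.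
  by rewrite expr2 -!gt0_powRD//; congr powR; ring.
rewrite ler_pdivlMr ?exprn_gt0// [leRHS]mulrC -mulrA ler_wpM2l ?powR_ge0//.
have : 1 <= x `^ r.
  by rewrite -[leLHS](powRr0 x) ler_powR ?(ltW x1)// ltW.
by nra.
Unshelve. all: end_near. Qed.

End powers.

(** * Cosine integrals and the Gamma function *)

Section cosine_integrals.
Context {R : realType}.
Local Notation mu := (@lebesgue_measure R).
Local Notation P := (`]0, +oo[%classic : set R).
Implicit Types (w : R -> R) (th x : R).

(** With phase 0 and pi/2 this gives the real part and the negated imaginary part of the integral of
    w(s) e^(-ixs). Keeping [th] free makes the family closed, up to the weight, under
    differentiation in [x] and integration by parts. *)
Definition cos_integral w th x : R := \int[mu]_(s in P) (w s * cos (x * s - th)).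

Lemma continuous_cos_affine x th : continuous (fun s => cos (x * s - th)).
Proof.
move=> s; apply: (@continuous_comp _ _ _ (fun s => x * s - th) cos);
  last exact: continuous_cos.
by apply: cvgB; [apply: cvgM; [exact: cvg_cst|exact: cvg_id]|exact: cvg_cst].
Qed.

Lemma integrable_cos w th x : mu.-integrable P (EFin \o w) ->
  mu.-integrable P (EFin \o (fun s => w s * cos (x * s - th))).
Proof.
move=> iw; have /integrableP[/measurable_EFinP mw _] := iw.
apply: (le_integrable _ _ _ iw); first exact: measurable_itv.
  apply/measurable_EFinP/measurable_funM => //.
  apply: measurable_funTS; apply: continuous_measurable_fun.
  exact: continuous_cos_affine.
move=> s _; rewrite /= lee_fin normrM -[leRHS]mulr1.
by rewrite ler_wpM2l ?cos_max.
Qed.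

(** Differentiation under the integral sign, dominated by [|s * w s|] uniformly in [x]. The factor -
    sin is again a cosine, with the phase lowered by pi/2. *)
Lemma is_derive_cos_integral w th x : mu.-integrable P (EFin \o w) ->
  mu.-integrable P (EFin \o (fun s => s * w s)) ->
  is_derive x 1 (cos_integral w th)
    (cos_integral (fun s => s * w s) (th - pi / 2) x).
Proof.
move=> iw isw.
pose f (y s : R) := w s * cos (y * s - th).
have df (y s : R) : is_derive y 1 (f ^~ s) (s * w s * cos (y * s - (th - pi / 2))).
  have d1 : is_derive y 1 (fun z => z * s - th) s.
    by apply: is_derive_eq; rewrite /GRing.scale/= ?mulr1 ?mulr0 subr0 ?add0r ?addr0.
  have d2 := @is_derive1_comp R cos (fun z => z * s - th) y _ _ (is_derive_cos _) d1.
  have -> : s * w s * cos (y * s - (th - pi / 2)) =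
      w s *: (- sin (y * s - th) * s).
    rewrite opprB addrCA [pi / 2 + _]addrC cosDpihalf /GRing.scale/=; ring.
  exact: is_deriveZ.
have d1E (y s : R) : partial1of2 f y s = s * w s * cos (y * s - (th - pi / 2)).
  by rewrite /partial1of2 derive1E; have [_ ->] := df y s.
have xI : `]x - 1, x + 1[%classic x.
  by rewrite /= in_itv/= gtrBl ltrDl ltr01.
pose G (s : R) : R := `|s * w s|.
have der (y s : R) : `]x - 1, x + 1[%classic y -> P s -> derivable (f ^~ s) y 1.
  by move=> _ _; have [] := df y s.
have intf (y : R) : `]x - 1, x + 1[%classic y -> mu.-integrable P (EFin \o f y).
  by move=> _; exact: integrable_cos.
have iG : mu.-integrable P (EFin \o G) by exact: integrable_norm.
have G0 (s : R) : 0 <= G s by exact: normr_ge0.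
have leG (y s : R) : `]x - 1, x + 1[%classic y -> P s -> `|partial1of2 f y s| <= G s.
  by move=> _ _; rewrite d1E normrM /G -[leRHS]mulr1 ler_wpM2l ?cos_max.
have mP : measurable (P : set (measurableTypeR R)) by exact: measurable_itv.
split.
  exact: (derivable_under_integral mP xI intf der G0 iG leG).
rewrite -derive1E (differentiation_under_integral mP xI intf der G0 iG leG).
by apply: eq_Rintegral => s _; rewrite d1E.
Qed.

Lemma cos_integral_le w th x : mu.-integrable P (EFin \o w) ->
  `|cos_integral w th x| <= \int[mu]_(s in P) `|w s|.
Proof.
move=> iw; have iwc := integrable_cos th x iw.
rewrite (le_trans (le_normr_Rintegral _ iwc))//.
apply: le_Rintegral => //; first exact: integrable_norm.
  exact: integrable_norm.
by move=> s _; rewrite normrM -[leRHS]mulr1 ler_wpM2l ?cos_max.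
Qed.

Lemma eq_cos_integral w1 w2 th x : (forall s : R, 0 < s -> w1 s = w2 s) ->
  cos_integral w1 th x = cos_integral w2 th x.
Proof.
move=> w12; apply: eq_Rintegral => s; rewrite inE/= in_itv/= andbT => s0.
by rewrite w12.
Qed.

Lemma cos_integralZ (c : R) w th x : mu.-integrable P (EFin \o w) ->
  cos_integral (fun s => c * w s) th x = c * cos_integral w th x.
Proof.
move=> iw; rewrite /cos_integral -RintegralZl//; last exact: integrable_cos.
by apply: eq_Rintegral => s _; rewrite mulrA.
Qed.

End cosine_integrals.

(** * Integration by parts and the cosine integral of the Gaussian *)

Section cosine_integrals_by_parts.
Context {R : realType}.
Local Notation mu := (@lebesgue_measure R).
Local Notation P := (`]0, +oo[%classic : set R).
Implicit Types (w W : R -> R) (th x : R).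

Lemma cos_integralBpi w th x : mu.-integrable P (EFin \o w) ->
  cos_integral w (th - pi) x = - cos_integral w th x.
Proof.
move=> iw; rewrite -[RHS]mulN1r /cos_integral -RintegralZl//; last exact: integrable_cos.
apply: eq_Rintegral => s _; rewrite opprB addrCA [pi + _]addrC cosDpi; ring.
Qed.

Lemma is_derive_cos_affine (x th s : R) :
  is_derive s 1 (fun s : R => cos (x * s - th)) (x * cos (x * s - (th - pi / 2))).
Proof.
have d1 : is_derive s 1 (fun z => x * z - th) x.
  by apply: is_derive_eq; rewrite /GRing.scale/= ?mulr1 ?mulr0 subr0 ?add0r ?addr0.
have := @is_derive1_comp R cos (fun z => x * z - th) s _ _ (is_derive_cos _) d1.
suff -> : x * cos (x * s - (th - pi / 2)) = - sin (x * s - th) * x by [].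
by rewrite opprB addrCA [pi / 2 + _]addrC cosDpihalf; ring.
Qed.

(** The left side integrates the derivative of W(s) cos (x s - th). Its boundary value is 0 at
    infinity and l cos (- th) at 0. *)
Lemma cos_integral_by_parts W w th x (l : R) :
  (forall s : R, 0 < s -> is_derive s 1 W (w s)) ->
  (forall s : R, 0 < s -> {for s, continuous w}) ->
  mu.-integrable P (EFin \o W) -> mu.-integrable P (EFin \o w) ->
  W s @[s --> 0^'+] --> l -> W s @[s --> +oo] --> 0 ->
  cos_integral w th x + x * cos_integral W (th - pi / 2) x = - (l * cos th).
Proof.
move=> dW cw iW iw Wl W0.
have icW := integrable_cos (th - pi / 2) x iW.
have icw := integrable_cos th x iw.
rewrite /cos_integral -RintegralZl// -RintegralD//; last first.
  rewrite (_ : _ \o _ = fun s => x%:E * (W s * cos (x * s - (th - pi / 2)))%:E)%E//.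
  by apply: integrableZl => //; exact: measurable_itv.
have cW (s : R) : 0 < s -> {for s, continuous W}.
  move=> s0; apply/differentiable_continuous/derivable1_diffP.
  by have [] := dW s s0.
rewrite -[RHS]add0r; apply: (@FTC2_0y _ (fun s : R => W s * cos (x * s - th))).
- move=> s s0; have d1 := dW s s0; have d2 := is_derive_cos_affine x th s.
  by apply: is_derive_eq; rewrite /GRing.scale/=; ring.
- move=> s s0; apply: cvgD.
    by apply: cvgM; [exact: cw|exact: continuous_cos_affine].
  apply: cvgM; first exact: cvg_cst.
  by apply: cvgM; [exact: cW|exact: continuous_cos_affine].
- rewrite (_ : _ \o _ = (EFin \o (fun s : R => w s * cos (x * s - th))%R) \+
    (fun s : R => x%:E * (EFin \o (fun s : R => W s * cos (x * s - (th - pi / 2)))%R) s))%E//.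
  apply: integrableD; [exact: measurable_itv|exact: icw|].
  by apply: integrableZl; [exact: measurable_itv|exact: icW].
- apply: cvgM => //; have <- : cos (x * 0 - th) = cos th.
    by rewrite mulr0 sub0r cosN.
  by apply: cvg_at_right_filter; exact: continuous_cos_affine.
- apply/cvgr0Pnorm_le => e e0.
  move/cvgr0Pnorm_le: W0 => /(_ e e0); apply: filterS => s Ws.
  by rewrite normrM (le_trans _ Ws)// -[leRHS]mulr1 ler_wpM2l// cos_max.
Qed.

Lemma is_derive_gauss (s : R) :
  is_derive s 1 (@gauss_fun R) (- 2 * (s * gauss_fun s)).
Proof.
have d1 : is_derive s 1 (fun z => - z ^+ 2) (- 2 * s).
  by apply: is_derive_eq; rewrite /GRing.scale/= ?mulr1; ring.
have := @is_derive1_comp R expR (fun z => - z ^+ 2) s _ _ (is_derive_expR _) d1.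
suff -> : - 2 * (s * gauss_fun s) = expR (- s ^+ 2) * (- 2 * s) by [].
by rewrite /gauss_fun; ring.
Qed.

Lemma integrable_gauss : mu.-integrable P (EFin \o @gauss_fun R).
Proof.
by apply: (integrableS measurableT) (@integrableT_gauss R) => //; exact: measurable_itv.
Qed.

Lemma gauss_cvg0 : gauss_fun s @[s --> 0^'+] --> (1 : R).
Proof.
have <- : gauss_fun (0 : R) = 1 by rewrite /gauss_fun expr0n/= oppr0 expR0.
by apply/cvg_at_right_filter; exact: continuous_gauss_fun.
Qed.

Lemma integrable_id_gauss : mu.-integrable P (EFin \o (fun s : R => s * gauss_fun s)).
Proof.
have dF (s : R) : 0 < s ->
    is_derive s 1 (fun s : R => (- 2^-1) * gauss_fun s) (s * gauss_fun s).
  move=> _; have d := is_derive_gauss s.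
  by apply: is_derive_eq; rewrite /GRing.scale/=; field.
have cg (s : R) : 0 < s -> {for s, continuous (fun s : R => s * gauss_fun s)}.
  by move=> _; apply: cvgM; [exact: cvg_id|exact: continuous_gauss_fun].
have g0 (s : R) : 0 < s -> 0 <= s * gauss_fun s.
  by move=> s0; rewrite mulr_ge0 ?gauss_fun_ge0// ltW.
apply: ge0_integrable_0y => //; first exact: continuous_measurable_pos.
rewrite (@ge0_FTC2_0y _ _ _ (- 2^-1 * 1) (- 2^-1 * 0) dF cg g0) ?ltry//.
- by apply: cvgM; [exact: cvg_cst|exact: gauss_cvg0].
- by apply: cvgM; [exact: cvg_cst|exact: cvg_gauss_fun].
Qed.

(** Integration by parts shows that the left side [G] solves G' = - (z/2) G, so G(z) e^(z^2/4) is
    constant; its value at 0 is the half-line Gaussian integral. *)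
Lemma cos_integral_gauss (y : R) :
  cos_integral (@gauss_fun R) 0 y = Num.sqrt pi / 2 * expR (- y ^+ 2 / 4).
Proof.
pose G : R -> R := cos_integral (@gauss_fun R) 0.
have dG (z : R) : is_derive z 1 G (- (z / 2) * G z).
  have d := is_derive_cos_integral 0 z integrable_gauss integrable_id_gauss.
  apply: is_derive_eq; rewrite sub0r.
  (* The phase - pi/2 makes the boundary term cos th vanish, although the Gaussian tends to 1 at 0.
     The other integral then has phase - pi, which is - [G]. *)
  have := @cos_integral_by_parts (@gauss_fun R) (fun s : R => -2 * (s * gauss_fun s))
    (- (pi / 2)) z 1.
  rewrite cosN cos_pihalf mulr0 oppr0 -opprD -splitr -[- pi]sub0r.
  rewrite cos_integralBpi ?integrable_gauss// cos_integralZ ?integrable_id_gauss//.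
  move=> h; apply/eqP; rewrite -subr_eq0; apply/eqP.
  have {}h : - 2 * cos_integral (fun s : R => s * gauss_fun s) (- (pi / 2)) z +
      z * - G z = 0.
    apply: h => //.
    - by move=> s _; exact: is_derive_gauss.
    - move=> s _; apply: cvgM; first exact: cvg_cst.
      by apply: cvgM; [exact: cvg_id|exact: continuous_gauss_fun].
    - rewrite (_ : _ \o _ = fun s => (-2)%:E * (s * gauss_fun s)%:E)%E//.
      by apply: integrableZl => //; exact: integrable_id_gauss.
    - exact: gauss_cvg0.
    - exact: cvg_gauss_fun.
  lra.
pose H (z : R) := G z * expR (z ^+ 2 / 4).
have dH (z : R) : is_derive z 1 H 0.
  have d1 : is_derive z 1 (fun z => z ^+ 2 / 4) (z / 2).
    by apply: is_derive_eq; rewrite /GRing.scale/= ?mulr1; field.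
  have d2 := @is_derive1_comp R expR (fun z => z ^+ 2 / 4) z _ _ (is_derive_expR _) d1.
  have d3 := dG z.
  have <- : G z *: (expR (z ^+ 2 / 4) * (z / 2)) +
      expR (z ^+ 2 / 4) *: (- (z / 2) * G z) = 0.
    by rewrite /GRing.scale/=; ring.
  exact: is_deriveM.
have G0 : G 0 = Num.sqrt pi / 2.
  rewrite /G /cos_integral /Rintegral.
  rewrite (@eq_integral_pos _ _ (fun s : R => (gauss_fun s)%:E)); last first.
    by move=> s _; rewrite mul0r subr0 cos0 mulr1.
  rewrite integral_itv_obnd_cbnd; first by rewrite integral0y_gauss.
  by apply/measurable_EFinP/measurable_funTS; exact: measurable_gauss_fun.
have := is_derive_0_is_cst y 0 dH.
rewrite /H expr0n/= mul0r expR0 mulr1 G0 => <-.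
by rewrite -mulrA -expRD mulNr subrr expR0 mulr1.
Qed.

End cosine_integrals_by_parts.

(** * Euler's integral and its cosine transforms *)

Section gamma_weight.
Context {R : realType}.
Local Notation mu := (@lebesgue_measure R).
Local Notation P := (`]0, +oo[%classic : set R).
Implicit Types (a th x : R).

Definition gamma_weight a (s : R) : R := s `^ (a - 1) * expR (- s).

Lemma GammaE a : Gamma a = \int[mu]_(s in P) gamma_weight a s.
Proof. by []. Qed.

Lemma gamma_weight_ge0 a s : 0 <= gamma_weight a s.
Proof. by rewrite mulr_ge0 ?powR_ge0 ?expR_ge0. Qed.

Lemma powR_continuous_pos a (s : R) : 0 < s -> {for s, continuous (fun s => s `^ a)}.
Proof.
move=> s0; apply/differentiable_continuous/derivable1_diffP.
by have [] := is_derive1_powR a s0.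
Qed.

Lemma continuous_expRN : continuous (fun s : R => expR (- s)).
Proof.
move=> s; apply: (@continuous_comp _ _ _ (fun s : R => - s) expR).
  by apply: cvgN; exact: cvg_id.
exact: continuous_expR.
Qed.

Lemma gamma_weight_continuous a (s : R) : 0 < s ->
  {for s, continuous (gamma_weight a)}.
Proof.
move=> s0; apply: cvgM; first exact: powR_continuous_pos.
exact: continuous_expRN.
Qed.

Lemma integrable_gamma_weight a : 0 < a ->
  mu.-integrable P (EFin \o gamma_weight a).
Proof.
(* The exponent a + 1 is chosen so that s^(a - 1) s^(- (a + 1)) = s^(-2), which is the decay
   required for q = 1. *)
move=> a0; have [C C0 hC] := @expRN_powR_le R (a + 1) (addr_gt0 a0 ltr01).
apply: (@integrable_0y_powR _ a 1 1 C) => //.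
- by apply: continuous_measurable_pos => s; exact: gamma_weight_continuous.
- move=> s s0 s1; rewrite ger0_norm ?gamma_weight_ge0// mul1r.
  rewrite -[leRHS]mulr1 ler_wpM2l ?powR_ge0//.
  by rewrite expR_le1 oppr_le0 ltW.
- move=> s s1; have s0 : 0 < s by exact: lt_trans s1.
  rewrite ger0_norm ?gamma_weight_ge0//.
  have -> : C * s `^ (-1 - 1) = s `^ (a - 1) * (C * s `^ (- (a + 1))).
    by rewrite mulrCA -gt0_powRD//; congr (_ * _ `^ _); ring.
  by rewrite ler_wpM2l ?powR_ge0// hC.
Qed.

Lemma gamma_weightS a (s : R) : 0 < s -> s * gamma_weight a s = gamma_weight (a + 1) s.
Proof.
move=> s0; rewrite /gamma_weight addrK mulrA; congr (_ * _).
by rewrite -{1}(powRr1 (ltW s0)) -gt0_powRD//; congr powR; ring.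
Qed.

Lemma is_derive_expRN (s : R) :
  is_derive s 1 (fun s : R => expR (- s)) (- expR (- s)).
Proof.
have d : is_derive s 1 (fun z : R => - z) (- 1).
  by apply: is_derive_eq; rewrite /GRing.scale/= ?mulr1.
have := @is_derive1_comp R expR (fun z => - z) s _ _ (is_derive_expR _) d.
suff -> : - expR (- s) = expR (- s) * - 1 by [].
by rewrite mulrN1.
Qed.

Lemma is_derive_gamma_weight a (s : R) : 0 < s ->
  is_derive s 1 (gamma_weight (a + 1)) (a * gamma_weight a s - gamma_weight (a + 1) s).
Proof.
move=> s0; have d1 := is_derive1_powR a s0.
have d2 := is_derive_expRN s.
rewrite /gamma_weight addrK.
by apply: is_derive_eq; rewrite /GRing.scale/=; ring.
Qed.

Lemma gamma_weight_cvg0 a : 0 < a -> gamma_weight (a + 1) s @[s --> 0^'+] --> 0.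
Proof.
move=> a0; rewrite /gamma_weight addrK -[X in _ --> X](mul0r (expR (- 0))).
apply: cvgM; first exact: powR_cvg0.
by apply: cvg_at_right_filter; exact: continuous_expRN.
Qed.

Lemma gamma_weight_cvgy a : 0 < a -> gamma_weight (a + 1) s @[s --> +oo] --> 0.
Proof.
move=> a0; have [C C0 hC] := @expRN_powR_le R (a + 1) (addr_gt0 a0 ltr01).
apply: (@squeeze_cvgr _ _ _ _ (cst 0) (fun s => C * s `^ (- 1))); last 2 first.
- exact: cvg_cst.
- by rewrite -[X in _ --> X](mulr0 C); apply: cvgM; [exact: cvg_cst|exact: powRN_cvg0y].
near=> s; have s0 : 0 < s by near: s; exact: nbhs_pinfty_gt.
rewrite /= gamma_weight_ge0/=.
have -> : C * s `^ (-1) = s `^ (a + 1 - 1) * (C * s `^ (- (a + 1))).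
  by rewrite mulrCA -gt0_powRD//; congr (_ * _ `^ _); ring.
by rewrite ler_wpM2l ?powR_ge0// hC.
Unshelve. all: end_near. Qed.

(** Integration by parts of s^a e^(-s), which vanishes at both ends and has derivative a s^(a - 1)
    e^(-s) - s^a e^(-s). At x = 0 and th = 0 it is the functional equation of Gamma. *)
Lemma cos_integral_gammaS a th x : 0 < a ->
  cos_integral (gamma_weight (a + 1)) th x =
    a * cos_integral (gamma_weight a) th x
    + x * cos_integral (gamma_weight (a + 1)) (th - pi / 2) x.
Proof.
move=> a0; have iw := integrable_gamma_weight a0.
have iW := integrable_gamma_weight (addr_gt0 a0 ltr01).
have iaw : mu.-integrable P (EFin \o (fun s => a * gamma_weight a s)).
  rewrite (_ : _ \o _ = fun s => a%:E * (gamma_weight a s)%:E)%E//.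
  by apply: integrableZl => //; exact: measurable_itv.
pose w (s : R) := a * gamma_weight a s - gamma_weight (a + 1) s.
have iw' : mu.-integrable P (EFin \o w).
  rewrite (_ : _ \o _ = (EFin \o (fun s => a * gamma_weight a s)%R) \-
    (EFin \o gamma_weight (a + 1)))%E//.
  by apply: integrableB; [exact: measurable_itv|exact: iaw|exact: iW].
have /(_ 0) := @cos_integral_by_parts R (gamma_weight (a + 1)) w th x.
rewrite mul0r oppr0 => h.
have {}h : cos_integral w th x + x * cos_integral (gamma_weight (a + 1)) (th - pi / 2) x = 0.
  apply: h => //.
  - by move=> s; exact: is_derive_gamma_weight.
  - move=> s s0; apply: cvgB; last exact: gamma_weight_continuous.
    by apply: cvgM; [exact: cvg_cst|exact: gamma_weight_continuous].
  - exact: gamma_weight_cvg0.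
  - exact: gamma_weight_cvgy.
have : cos_integral w th x =
    a * cos_integral (gamma_weight a) th x - cos_integral (gamma_weight (a + 1)) th x.
  rewrite -cos_integralZ// /cos_integral -RintegralB//; last 2 first.
  - exact: integrable_cos.
  - exact: integrable_cos.
  by apply: eq_Rintegral => s _; rewrite -mulrBl.
lra.
Qed.

Lemma GammaS a : 0 < a -> Gamma (a + 1) = a * Gamma a.
Proof.
move=> a0; have := cos_integral_gammaS 0 0 a0; rewrite mul0r addr0.
have E b : cos_integral (gamma_weight b) 0 0 = Gamma b.
  by apply: eq_Rintegral => s _; rewrite mul0r subr0 cos0 mulr1.
by rewrite !E.
Qed.

Lemma Gamma1 : Gamma (1 : R) = 1.
Proof.
have dF (s : R) : 0 < s -> is_derive s 1 (fun s : R => - expR (- s)) (gamma_weight 1 s).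
  move=> s0; have d := is_derive_expRN s.
  by apply: is_derive_eq; rewrite /gamma_weight subrr powRr0 mul1r opprK.
transitivity (- 0 - - expR (- 0) : R); last by rewrite oppr0 expR0; ring.
rewrite GammaE; apply: (FTC2_0y dF).
- by move=> s; exact: gamma_weight_continuous.
- exact: integrable_gamma_weight.
- apply: cvgN; apply: cvg_at_right_filter; exact: continuous_expRN.
- by apply: cvgN; exact: cvgr_expR.
Qed.

Lemma Gamma_gt0 a : 0 < a -> 0 < Gamma a.
Proof.
move=> a0; have iw := integrable_gamma_weight a0.
have mw : measurable_fun P (EFin \o gamma_weight a).
  by have /integrableP[] := iw.
(* On [1, 2] one has s^(a - 1) >= s^(-1) >= 1/2, because a > 0, and e^(-s) >= e^(-2). *)
pose c : R := 2^-1 * expR (- 2).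
have c0 : 0 < c by rewrite mulr_gt0 ?invr_gt0 ?expR_gt0.
have sub12 : `[1, 2]%classic `<=` P.
  move=> s; rewrite /= !in_itv/= andbT => /andP[+ _]; exact: lt_le_trans.
have lec (s : R) : 1 <= s <= 2 -> c <= gamma_weight a s.
  move=> /andP[s1 s2]; have s0 : 0 < s by exact: lt_le_trans s1.
  rewrite ler_pM ?invr_ge0 ?expR_ge0// ?ler_expR ?lerN2//.
  rewrite gt0_powRD// powR_inv1 ?(ltW s0)// -[leLHS]mul1r ler_pM ?invr_ge0//.
    by rewrite -[leLHS](powRr0 s) ler_powR// ltW.
  by rewrite lef_pV2 ?posrE.
rewrite GammaE -lte_fin /Rintegral fineK; last exact: integrable_fin_num.
apply: (@lt_le_trans _ _ (\int[mu]_(s in `[1%R, 2%R]) (gamma_weight a s)%:E)%E).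
  apply: (@lt_le_trans _ _ (\int[mu]_(s in `[1%R, 2%R]) (cst c%:E) s)%E).
    rewrite integral_cst//= lebesgue_measure_itv/= lte_fin ltr1n/=.
    by rewrite -EFinD -EFinM lte_fin mulr_gt0//; lra.
  apply: ge0_le_integral; [by []|by move=> s _; rewrite lee_fin ltW|by []| |].
  - by apply: measurable_funS mw; [exact: measurable_itv|].
  - by move=> s; rewrite /= in_itv/= lee_fin; exact: lec.
apply: ge0_subset_integral => //.
by move=> s _; rewrite lee_fin gamma_weight_ge0.
Qed.

(** With [S] the cosine integral of phase th - pi/2, F = C + iS is the integral of the weight times
    e^(-i(xs - th)). It solves (1 + ix) F' = - i a F, so F (1 + ix)^a is constant. The proof carries
    this out on real and imaginary parts, with (1 + ix)^a in polar form. *)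
Lemma cos_integral_gamma a th x : 0 < a ->
  cos_integral (gamma_weight a) th x =
    Gamma a * (1 + x ^+ 2) `^ (- (a / 2)) * cos (a * atan x - th).
Proof.
move=> a0; have iw := integrable_gamma_weight a0.
have iW := integrable_gamma_weight (addr_gt0 a0 ltr01).
have isw : mu.-integrable P (EFin \o (fun s => s * gamma_weight a s)).
  apply: (@eq_integrable _ (measurableTypeR R) _ mu P (measurable_itv _) _ _ _ iW).
  move=> s; rewrite inE/= in_itv/= andbT => s0.
  by rewrite gamma_weightS.
pose C := cos_integral (gamma_weight a) th.
pose S := cos_integral (gamma_weight a) (th - pi / 2).
have D0 z : 0 < 1 + z ^+ 2 :> R by rewrite ltr_pwDl// sqr_ge0.
have DC (z : R) : is_derive z 1 C (a * (S z - z * C z) / (1 + z ^+ 2)).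
  have d := is_derive_cos_integral th z iw isw; apply: is_derive_eq.
  rewrite (eq_cos_integral _ _ (fun s => @gamma_weightS a s)).
  (* The two recurrences form a linear system for the integrals [v] and [u] of weight a + 1, with
     phases th and th - pi/2: v = a C + z u and u = a S - z v. Its determinant 1 + z^2 gives the
     denominator. *)
  have := cos_integral_gammaS th z a0; have := cos_integral_gammaS (th - pi / 2) z a0.
  rewrite -addrA -opprD -splitr cos_integralBpi//= -/(C z) -/(S z).
  move: (cos_integral _ (th - _) _) (cos_integral _ th _) => u v uE vE.
  have z2 := D0 z; rewrite vE in uE; apply/(mulIf (lt0r_neq0 z2)).
  by rewrite divfK ?lt0r_neq0//; lra.
have DS (z : R) : is_derive z 1 S (- a * (C z + z * S z) / (1 + z ^+ 2)).
  have d := is_derive_cos_integral (th - pi / 2) z iw isw; apply: is_derive_eq.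
  rewrite (eq_cos_integral _ _ (fun s => @gamma_weightS a s)).
  have := cos_integral_gammaS th z a0; have := cos_integral_gammaS (th - pi / 2) z a0.
  rewrite -addrA -opprD -splitr cos_integralBpi//= -/(C z) -/(S z).
  move: (cos_integral _ (th - _) _) (cos_integral _ th _) => u v uE vE.
  have z2 := D0 z; rewrite uE in vE; apply/(mulIf (lt0r_neq0 z2)).
  by rewrite divfK ?lt0r_neq0//; lra.
pose q (z : R) := (1 + z ^+ 2) `^ (a / 2).
have Dq (z : R) : is_derive z 1 q (a * z / (1 + z ^+ 2) * q z).
  have d1 : is_derive z 1 (fun z => 1 + z ^+ 2) (2 * z).
    by apply: is_derive_eq; rewrite /GRing.scale/= ?mulr1; ring.
  have := @is_derive1_comp R (fun y => y `^ (a / 2)) (fun z => 1 + z ^+ 2) z _ _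
    (is_derive1_powR _ (D0 z)) d1.
  suff -> : a * z / (1 + z ^+ 2) * q z =
    a / 2 * (1 + z ^+ 2) `^ (a / 2 - 1) * (2 * z) by [].
  rewrite gt0_powRD// powR_inv1 ?(ltW (D0 _))// /q; field.
  by rewrite lt0r_neq0.
have Dg (z : R) : is_derive z 1 (fun z => a * atan z - th) (a / (1 + z ^+ 2)).
  by apply: is_derive_eq; rewrite /GRing.scale/= ?subr0.
have Dc (z : R) := @is_derive1_comp R cos _ z _ _ (is_derive_cos _) (Dg z).
have Ds (z : R) := @is_derive1_comp R sin _ z _ _ (is_derive_sin _) (Dg z).
pose c (z : R) := cos (a * atan z - th).
pose s (z : R) := sin (a * atan z - th).
have {}Dc (z : R) : is_derive z 1 c (- s z * (a / (1 + z ^+ 2))) by exact: Dc.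
have {}Ds (z : R) : is_derive z 1 s (c z * (a / (1 + z ^+ 2))) by exact: Ds.
(* [E1] and [E2] treat the real and imaginary parts of F (1 + iz)^a e^(-i th). Evaluation at 0 gives
   the constants Gamma(a) and 0. *)
have E1 (z : R) : is_derive z 1 (fun z => q z * (C z * c z - S z * s z)) 0.
  have d1 := DC z; have d2 := DS z; have d3 := Dc z; have d4 := Ds z; have d5 := Dq z.
  apply: is_derive_eq; rewrite /GRing.scale/=; field.
  by rewrite lt0r_neq0.
have E2 (z : R) : is_derive z 1 (fun z => q z * (C z * s z + S z * c z)) 0.
  have d1 := DC z; have d2 := DS z; have d3 := Dc z; have d4 := Ds z; have d5 := Dq z.
  apply: is_derive_eq; rewrite /GRing.scale/=; field.
  by rewrite lt0r_neq0.
have at0 t : cos_integral (gamma_weight a) t 0 = Gamma a * cos t.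
  rewrite /cos_integral GammaE -RintegralZr//.
  by apply: eq_Rintegral => r _; rewrite mul0r sub0r cosN.
have := is_derive_0_is_cst x 0 E1; have := is_derive_0_is_cst x 0 E2.
have -> : q 0 = 1 by rewrite /q expr0n/= addr0 powR1.
rewrite /c /s /C /S !at0 atan0 mulr0 sub0r cosN sinN -/(C x) -/(S x) -/(c x) -/(s x).
have -> : cos (th - pi / 2) = sin th by rewrite cosB cos_pihalf sin_pihalf; ring.
have cs1 := cos2Dsin2 th; have cs2 := cos2Dsin2 (a * atan x - th).
rewrite -/(c x) -/(s x) in cs2 *.
have q0 : 0 < q x by rewrite powR_gt0.
rewrite powRN -/(q x) => e2 e1.
apply/(mulfI (lt0r_neq0 q0)).
have -> : q x * (Gamma a / q x * c x) = Gamma a * c x by field; rewrite lt0r_neq0.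
(* [C] is recovered from the two constants by the inverse rotation, that is multiplication by c - i
   s. *)
have -> : q x * C x = q x * C x * (c x ^+ 2 + s x ^+ 2) by rewrite cs2 mulr1.
have -> : q x * C x * (c x ^+ 2 + s x ^+ 2) =
  q x * (C x * c x - S x * s x) * c x + q x * (C x * s x + S x * c x) * s x by ring.
rewrite e1 e2.
have -> : Gamma a * c x = Gamma a * c x * (cos th ^+ 2 + sin th ^+ 2).
  by rewrite cs1 mulr1.
ring.
Qed.

End gamma_weight.

(** * The kernel of the fractional Laplacian *)

Section fubini_quadrant.
Context {R : realType}.
Local Notation mu := (@lebesgue_measure R).
Local Notation T := (measurableTypeR R).
Local Notation P := (`]0, +oo[%classic : set R).
Local Open Scope ereal_scope.

(** Extension by zero off the open quadrant, so that the theorems on the whole plane apply;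
    multiplying by indicators keeps measurability immediate. *)
Let quadrant (f : T * T -> R) (z : T * T) : R :=
  (f z * (\1_P z.1 * \1_P z.2))%R.

Let quadrantE (f : T * T -> R) (x y : R) : (0 < x)%R -> (0 < y)%R ->
  quadrant f (x, y) = f (x, y).
Proof.
move=> x0 y0.
by rewrite /quadrant /= !indicE !mem_set/= ?in_itv/= ?andbT// !mulr1.
Qed.

Let quadrant_ge0 (f : T * T -> R) z :
  (forall x y : R, 0 < x -> 0 < y -> 0 <= f (x, y))%R -> (0 <= quadrant f z)%R.
Proof.
case: z => x y f0; rewrite /quadrant /= !indicE.
case: (boolP (x \in _)) => [|_]; last by rewrite mul0r mulr0.
case: (boolP (y \in _)) => [|_]; last by rewrite !mulr0.
rewrite !inE/= !in_itv/= !andbT !mulr1 => y0 x0; exact: f0.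
Qed.

Let measurable_quadrant (f : T * T -> R) : measurable_fun setT f ->
  measurable_fun setT (EFin \o quadrant f).
Proof.
move=> mf; apply/measurable_EFinP; apply: measurable_funM => //.
by apply: measurable_funM; apply: measurableT_comp => //.
Qed.

Let integral_quadrant2 (g : R -> R -> \bar R) (f : T * T -> R) :
  (forall x y : R, (0 < x)%R -> (0 < y)%R -> g x y = (f (x, y))%:E) ->
  (forall x y : R, ~ ((0 < x)%R /\ (0 < y)%R) -> g x y = 0) ->
  \int[mu]_x \int[mu]_y g x y =
  \int[mu]_(x in P) \int[mu]_(y in P) (f (x, y))%:E.
Proof.
move=> gf g0; rewrite [RHS]integral_mkcond; apply: eq_integral => x _.
rewrite patchE; case: ifPn => [|].
  rewrite inE/= in_itv/= andbT => x0.
  rewrite [RHS]integral_mkcond; apply: eq_integral => y _.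
  rewrite patchE; case: ifPn => [|].
    by rewrite inE/= in_itv/= andbT => y0; exact: gf.
  by rewrite notin_setE/= in_itv/= andbT => y0; apply: g0 => -[].
rewrite notin_setE/= in_itv/= andbT => x0.
by apply: integral0_eq => y _; apply: g0 => -[].
Qed.

Let quadrant_out (f : T * T -> R) (x y : R) :
  ~ ((0 < x)%R /\ (0 < y)%R) -> quadrant f (x, y) = 0%R.
Proof.
move=> xy; rewrite /quadrant/= !indicE.
case: (boolP (x \in _)) => [|_]; last by rewrite mul0r mulr0.
case: (boolP (y \in _)) => [|_]; last by rewrite !mulr0.
by rewrite !inE/= !in_itv/= !andbT => y0 x0; case: xy.
Qed.

Lemma tonelli_0y (f : T * T -> R) : measurable_fun setT f ->
  (forall x y : R, 0 < x -> 0 < y -> 0 <= f (x, y))%R ->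
  \int[mu]_(x in P) \int[mu]_(y in P) (f (x, y))%:E =
  \int[mu]_(y in P) \int[mu]_(x in P) (f (x, y))%:E.
Proof.
move=> mf f0.
rewrite -(@integral_quadrant2 (fun x y => (quadrant f (x, y))%:E)); last 2 first.
- by move=> x y x0 y0; rewrite quadrantE.
- by move=> x y xy; rewrite quadrant_out.
rewrite -(@integral_quadrant2 (fun y x => (quadrant f (x, y))%:E)
  (fun z => f (z.2, z.1))); last 2 first.
- by move=> x y x0 y0; rewrite quadrantE.
- by move=> x y xy; rewrite quadrant_out// => -[y0 x0]; exact: xy.
have q0 z : 0 <= (EFin \o quadrant f) z by rewrite /= lee_fin quadrant_ge0.
have := @fubini_tonelli _ _ T T R mu mu _ (measurable_quadrant mf) q0.
exact.
Qed.

(** Absolute convergence is checked in one order while integrability of the partial integral is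
    obtained for the other. In the application, integrating the first variable first gives an
    explicit value, and the integrability obtained is that of the folded difference quotient. *)
Lemma fubini_0y (f : T * T -> R) : measurable_fun setT f ->
  \int[mu]_(y in P) \int[mu]_(x in P) `|(f (x, y))%:E| < +oo ->
  mu.-integrable P (fun x => \int[mu]_(y in P) (f (x, y))%:E) /\
  \int[mu]_(x in P) \int[mu]_(y in P) (f (x, y))%:E =
  \int[mu]_(y in P) \int[mu]_(x in P) (f (x, y))%:E.
Proof.
move=> mf foo; have mq := measurable_quadrant mf.
have iq : (mu \x mu).-integrable setT (EFin \o quadrant f).
  apply/(integrable21ltyP mu mu mq).
  rewrite (@integral_quadrant2 (fun y x => `|(quadrant f (x, y))%:E|)
    (fun z => `|f (z.2, z.1)|%R)) => //.
  - by move=> x y x0 y0; rewrite quadrantE.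
  - by move=> x y xy; rewrite quadrant_out ?abse0// => -[y0 x0]; exact: xy.
split.
  have := integrable_fubini_F iq; rewrite /fubini_F => iF.
  have iFP := @integrableS _ T R mu setT P _ measurableT (measurable_itv _)
    (@subsetT _ _) iF.
  apply: (@eq_integrable _ T _ mu P (measurable_itv _) _ _ _ iFP) => x.
  rewrite inE/= in_itv/= andbT => x0.
  rewrite [RHS]integral_mkcond; apply: eq_integral => y _.
  rewrite patchE; case: ifPn => [|].
    by rewrite inE/= in_itv/= andbT => y0; rewrite quadrantE.
  by rewrite notin_setE/= in_itv/= andbT => y0; rewrite quadrant_out// => -[].
rewrite -(@integral_quadrant2 (fun x y => (quadrant f (x, y))%:E)); last 2 first.
- by move=> x y x0 y0; rewrite quadrantE.
- by move=> x y xy; rewrite quadrant_out.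
rewrite -(@integral_quadrant2 (fun y x => (quadrant f (x, y))%:E)
  (fun z => f (z.2, z.1))); last 2 first.
- by move=> x y x0 y0; rewrite quadrantE.
- by move=> x y xy; rewrite quadrant_out// => -[y0 x0]; exact: xy.
exact: (Fubini iq).
Qed.

End fubini_quadrant.

(** * The integral of (1 - cos (sy)) / y^(1 + alpha) and its constant *)

Section riesz_kernel.
Context {R : realType}.
Local Notation mu := (@lebesgue_measure R).
Local Notation P := (`]0, +oo[%classic : set R).
Variable alpha : R.
Hypotheses (alpha_gt0 : 0 < alpha) (alpha_lt2 : alpha < 2).

Lemma norm_sin_le (t : R) : 0 < t -> `|sin t| <= t.
Proof.
move=> t0; have [|c _] := @MVT R sin cos 0 t t0.
  by apply: continuous_subspaceT; exact: continuous_sin.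
rewrite sin0 !subr0 => ->; rewrite normrM (gtr0_norm t0) -[leRHS]mul1r.
by rewrite ler_wpM2r ?cos_max// ltW.
Qed.

Lemma onem_cos_ge0 (t : R) : 0 <= 1 - cos t.
Proof. by rewrite subr_ge0 cos_le1. Qed.

(** From the half-angle formula 1 - cos t = 2 sin(t/2)^2. *)
Lemma onem_cos_le (t : R) : 0 < t -> 1 - cos t <= t ^+ 2.
Proof.
move=> t0; have t20 : 0 < t / 2 by rewrite divr_gt0.
have := norm_sin_le t20; have := cos2Dsin2 (t / 2).
have -> : cos t = cos (t / 2) ^+ 2 *+ 2 - 1.
  by rewrite -cos_mulr2n -(mulr_natr (t / 2)) divfK.
move=> h1; rewrite -(ler_sqr (normr_nneg _)) ?nnegrE ?(ltW t20)// real_normK ?num_real//.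
nra.
Qed.

Definition riesz_kernel (s y : R) : R := (1 - cos (s * y)) * y `^ (-1 - alpha).

Definition riesz_constant : R := \int[mu]_(y in P) riesz_kernel 1 y.

Lemma riesz_kernel_ge0 s y : 0 <= riesz_kernel s y.
Proof. by rewrite mulr_ge0 ?onem_cos_ge0 ?powR_ge0. Qed.

Lemma continuous_onem_cos (s : R) : continuous (fun y : R => 1 - cos (s * y)).
Proof.
move=> y; apply: cvgB; first exact: cvg_cst.
apply: (@continuous_comp _ _ _ (fun y : R => s * y) cos); last exact: continuous_cos.
by apply: cvgM; [exact: cvg_cst|exact: cvg_id].
Qed.

Lemma riesz_kernel_continuous (s : R) (y : R) : 0 < y -> {for y, continuous (riesz_kernel s)}.
Proof.
move=> y0; apply: cvgM; first exact: continuous_onem_cos.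
exact: powR_continuous_pos.
Qed.

(** Both bounds on [alpha] are used: the kernel is at most s^2 y^(1 - alpha) near 0, which is
    integrable since alpha < 2, and at most 2 y^(-1 - alpha) at infinity, integrable since alpha >
    0. *)
Lemma integrable_riesz_kernel s : 0 < s -> mu.-integrable P (EFin \o riesz_kernel s).
Proof.
move=> s0; apply: (@integrable_0y_powR _ (2 - alpha) alpha (s ^+ 2) 2) => //.
- by rewrite subr_gt0.
- by apply: continuous_measurable_pos => y; exact: riesz_kernel_continuous.
- move=> y y0 y1; rewrite ger0_norm ?riesz_kernel_ge0//.
  have -> : s ^+ 2 * y `^ (2 - alpha - 1) = (s * y) ^+ 2 * y `^ (-1 - alpha).
    rewrite exprMn -[RHS]mulrA -[y ^+ 2]powR_mulrn ?(ltW y0)// -gt0_powRD//.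
    by congr (_ * _ `^ _); ring.
  by rewrite ler_wpM2r ?powR_ge0// onem_cos_le// mulr_gt0.
- move=> y y1; rewrite ger0_norm ?riesz_kernel_ge0// addrC.
  rewrite ler_wpM2r ?powR_ge0//.
  by have := cos_geN1 (s * y); lra.
Qed.

(** Homogeneity: the kernel at (s, y) is s^(1 + alpha) times the kernel at (1, s y), and the change
    of variable takes back one factor s. *)
Lemma integral_riesz_kernel s : 0 < s ->
  (\int[mu]_(y in P) (riesz_kernel s y)%:E = (s `^ alpha * riesz_constant)%:E)%E.
Proof.
move=> s0; have iK := integrable_riesz_kernel ltr01.
have iKs := integrable_riesz_kernel s0.
have KE : (riesz_constant%:E = \int[mu]_(y in P) (riesz_kernel 1 y)%:E)%E.
  rewrite /riesz_constant /Rintegral fineK//; apply: integrable_fin_num => //.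
have := @ge0_integral_scale_0y R s (riesz_kernel 1) s0.
rewrite -KE => h; rewrite EFinM h; last 2 first.
- by move=> y; exact: riesz_kernel_continuous.
- by move=> y _; exact: riesz_kernel_ge0.
rewrite -ge0_integralZl//=.
- apply: eq_integral_pos => y y0; rewrite -EFinM; congr EFin.
  rewrite /riesz_kernel mul1r powRM ?(ltW s0) ?(ltW y0)//.
  rewrite (_ : s `^ (-1 - alpha) = s `^ (- alpha) * s `^ (-1)); last first.
    by rewrite -gt0_powRD// addrC.
  have : s `^ alpha * s `^ (- alpha) = 1 by rewrite -gt0_powRD// subrr powRr0.
  rewrite (powR_inv1 (ltW s0)).
  move: (s `^ alpha) (s `^ (- alpha)) (y `^ _) => u v r uv.
  have -> : u * ((1 - cos (s * y)) * (v / s * r) * s) = (u * v) * ((1 - cos (s * y)) * r).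
    by field; exact: lt0r_neq0.
  by rewrite uv mul1r.
- apply/measurable_EFinP; apply: continuous_measurable_pos => y y0.
  apply: cvgM; last exact: cvg_cst.
  apply: (@continuous_comp _ _ _ (fun y : R => s * y) (riesz_kernel 1)).
    by apply: cvgM; [exact: cvg_cst|exact: cvg_id].
  by apply: riesz_kernel_continuous; rewrite mulr_gt0.
- by move=> y; rewrite in_itv/= andbT => y0; rewrite lee_fin mulr_ge0 ?riesz_kernel_ge0// ltW.
- by rewrite lee_fin powR_ge0.
Qed.

(** Integration by parts with F(v) = - v^(-b) (1 - e^(-v)) / b, whose derivative is the integrand
    minus v^(-b) e^(-v) / b. Since 1 - e^(-v) <= min(v, 1), |F| is at most v^(1 - b) / b and at most
    v^(-b) / b, so it vanishes at 0 and at infinity. *)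
Lemma integral_onem_expRN (b : R) : 0 < b -> b < 1 ->
  (\int[mu]_(v in P) (v `^ (-1 - b) * (1 - expR (- v)))%:E = (Gamma (1 - b) / b)%:E)%E.
Proof.
move=> b0 b1; pose m (v : R) := v `^ (-1 - b) * (1 - expR (- v)).
have ig : mu.-integrable P (EFin \o gamma_weight (1 - b)).
  by apply: integrable_gamma_weight; rewrite subr_gt0.
have e01 (v : R) : 0 < v -> 0 <= 1 - expR (- v) <= Num.min v 1.
  move=> v0; rewrite subr_ge0 expR_le1 oppr_le0 (ltW v0)/= le_min.
  have := expR_ge1Dx (- v); have := expR_gt0 (- v).
  by move=> h1 h2; apply/andP; split; lra.
have m0 (v : R) : 0 < v -> 0 <= m v.
  by move=> /e01/andP[e0 _]; rewrite mulr_ge0 ?powR_ge0.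
have cm (v : R) : 0 < v -> {for v, continuous m}.
  move=> v0; apply: cvgM; first exact: powR_continuous_pos.
  by apply: cvgB; [exact: cvg_cst|exact: continuous_expRN].
have im : mu.-integrable P (EFin \o m).
  apply: (@integrable_0y_powR _ (1 - b) b 1 1) => //.
  - by rewrite subr_gt0.
  - exact: continuous_measurable_pos.
  - move=> v v0 v1; rewrite ger0_norm ?m0// mul1r.
    have -> : v `^ (1 - b - 1) = v `^ (-1 - b) * v.
      by rewrite -{3}(powRr1 (ltW v0)) -gt0_powRD//; congr powR; ring.
    rewrite /m ler_wpM2l ?powR_ge0//; have /andP[_] := e01 _ v0.
    by rewrite le_min => /andP[].
  - move=> v v1; have v0 : 0 < v by exact: lt_trans v1.
    rewrite ger0_norm ?m0// mul1r (_ : - b - 1 = -1 - b); last by ring.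
    by rewrite /m -[leRHS]mulr1 ler_wpM2l ?powR_ge0//; have /andP[_] := e01 _ v0;
      rewrite le_min => /andP[].
rewrite -[LHS]fineK; last exact: integrable_fin_num.
congr EFin; rewrite -[LHS]/(\int[mu]_(v in P) m v)%R.
pose F (v : R) := - b^-1 * (v `^ (- b) * (1 - expR (- v))).
have dF (v : R) : 0 < v ->
    is_derive v 1 F (m v - b^-1 * gamma_weight (1 - b) v).
  move=> v0; have d1 := is_derive1_powR (- b) v0; have d2 := is_derive_expRN v.
  apply: is_derive_eq; rewrite /GRing.scale/= /m /gamma_weight.
  rewrite (_ : 1 - b - 1 = - b); last by ring.
  rewrite (_ : - b - 1 = -1 - b); last by ring.
  field.
  exact: lt0r_neq0.
have Fb (v : R) : 0 < v -> `|F v| <= b^-1 * (v `^ (- b) * Num.min v 1).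
  move=> v0; have /andP[e0 e1] := e01 _ v0.
  rewrite normrM normrN !ger0_norm ?mulr_ge0 ?powR_ge0 ?invr_ge0 ?(ltW b0)//.
  by rewrite !ler_wpM2l ?powR_ge0 ?invr_ge0 ?(ltW b0).
have ibg : mu.-integrable P (EFin \o (fun v : R => b^-1 * gamma_weight (1 - b) v)).
  rewrite (_ : _ \o _ = fun s => (b^-1)%:E * (gamma_weight (1 - b) s)%:E)%E//.
  by apply: integrableZl => //; exact: measurable_itv.
have /eqP : \int[mu]_(v in P) (m v - b^-1 * gamma_weight (1 - b) v) = 0 - 0.
  apply: (FTC2_0y dF).
  - move=> v v0; apply: cvgB; first exact: cm.
    by apply: cvgM; [exact: cvg_cst|exact: gamma_weight_continuous].
  - rewrite (_ : _ \o _ = (EFin \o m) \-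
      (EFin \o (fun v : R => b^-1 * gamma_weight (1 - b) v)%R))%E//.
    by apply: integrableB; [exact: measurable_itv|exact: im|exact: ibg].
  - apply/norm_cvg0P; apply: (@squeeze_cvgr _ _ _ _ (cst 0) (fun v : R => b^-1 * v `^ (1 - b))).
    + near=> v; have v0 : 0 < v by near: v; exact: nbhs_right_gt.
      rewrite normr_ge0/= (le_trans (Fb _ v0))// ler_wpM2l ?invr_ge0 ?(ltW b0)//.
      rewrite addrC gt0_powRD// powRr1 ?(ltW v0)// ler_wpM2l ?powR_ge0//.
      by rewrite ge_min lexx.
    + exact: cvg_cst.
    + rewrite -[X in _ --> X](mulr0 b^-1); apply: cvgM; first exact: cvg_cst.
      by apply: powR_cvg0; rewrite subr_gt0.
  - apply/norm_cvg0P; apply: (@squeeze_cvgr _ _ _ _ (cst 0) (fun v : R => b^-1 * v `^ (- b))).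
    + near=> v; have v0 : 0 < v by near: v; exact: nbhs_pinfty_gt.
      rewrite normr_ge0/= (le_trans (Fb _ v0))// ler_wpM2l ?invr_ge0 ?(ltW b0)//.
      by rewrite -[leRHS]mulr1 ler_wpM2l ?powR_ge0// ge_min lexx orbT.
    + exact: cvg_cst.
    + rewrite -[X in _ --> X](mulr0 b^-1); apply: cvgM; first exact: cvg_cst.
      exact: powRN_cvg0y.
rewrite RintegralB// RintegralZl// subrr subr_eq0 => /eqP ->.
by rewrite GammaE mulrC.
Unshelve. all: end_near. Qed.

(** Euler's integral after the substitution t = s^2. *)
Lemma Gamma_gauss (a : R) : 0 < a ->
  (\int[mu]_(s in P) (s `^ (2 * a - 1) * gauss_fun s)%:E = (Gamma a / 2)%:E)%E.
Proof.
move=> a0; have ig := integrable_gamma_weight a0.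
have mh : measurable_fun P (fun s : R => (s `^ (2 * a - 1) * gauss_fun s)%:E).
  apply/measurable_EFinP; apply: continuous_measurable_pos => s s0.
  by apply: cvgM; [exact: powR_continuous_pos|exact: continuous_gauss_fun].
have h0 (s : R) : 0 <= s `^ (2 * a - 1) * gauss_fun s.
  by rewrite mulr_ge0 ?powR_ge0 ?gauss_fun_ge0.
have GE : ((Gamma a)%:E = \int[mu]_(s in P) (gamma_weight a s)%:E)%E.
  by rewrite GammaE /Rintegral fineK//; apply: integrable_fin_num.
rewrite (mulrC (Gamma a)) EFinM GE (@ge0_integral_sqr_0y _ (gamma_weight a)); last 2 first.
- by move=> s; exact: gamma_weight_continuous.
- by move=> s _; exact: gamma_weight_ge0.
rewrite -ge0_integralZl//=.
- apply: eq_integral_pos => s s0; rewrite -EFinM; congr EFin.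
  rewrite /gamma_weight /gauss_fun -powR_mulrn ?(ltW s0)// -powRrM.
  have -> : s `^ (2 * a - 1) = s `^ (2%:R * (a - 1)) * s.
    by rewrite -{3}(powRr1 (ltW s0)) -gt0_powRD//; congr powR; ring.
  by field.
- apply/measurable_EFinP; apply: continuous_measurable_pos => s s0.
  apply: cvgM; last by apply: cvgM; [exact: cvg_cst|exact: cvg_id].
  apply: (@continuous_comp _ _ _ (fun s : R => s ^+ 2) (gamma_weight a)).
    exact: exprn_continuous.
  by apply: gamma_weight_continuous; rewrite exprn_gt0.
- move=> s; rewrite in_itv/= andbT => s0.
  by rewrite lee_fin mulr_ge0 ?gamma_weight_ge0// mulr_ge0// ltW.
Qed.

(** The substitution v = (y/2)^2 in [integral_onem_expRN] at b = alpha/2, made as a squaring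
    followed by a scaling by 1/2, whose powers of 2 collect into the prefactor. *)
Lemma integral_onem_gauss :
  (\int[mu]_(y in P) (y `^ (-1 - alpha) * (1 - expR (- y ^+ 2 / 4)))%:E =
   (2 `^ (-1 - alpha) * (Gamma (1 - alpha / 2) / (alpha / 2)))%:E)%E.
Proof.
have b0 : 0 < alpha / 2 by rewrite divr_gt0.
have b1 : alpha / 2 < 1 by rewrite ltr_pdivrMr// mul1r.
have onem0 (z : R) : 0 <= z -> 0 <= 1 - expR (- z).
  by move=> z0; rewrite subr_ge0 expR_le1 oppr_le0.
have cexp (u : R -> R) (s : R) : {for s, continuous u} ->
    {for s, continuous (fun s => 1 - expR (- u s))}.
  move=> cu; apply: cvgB; first exact: cvg_cst.
  by apply: (@continuous_comp _ _ _ u (fun z => expR (- z))) => //; exact: continuous_expRN.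
have csqr : continuous (fun s : R => s ^+ 2) by exact: exprn_continuous.
pose g (s : R) := (s ^+ 2) `^ (-1 - alpha / 2) * (1 - expR (- s ^+ 2)) * (2 * s).
have g0 (s : R) : 0 < s -> 0 <= g s.
  by move=> s0; rewrite !mulr_ge0 ?powR_ge0 ?onem0 ?sqr_ge0// ltW.
have cg (s : R) : 0 < s -> {for s, continuous g}.
  move=> s0; apply: cvgM; last by apply: cvgM; [exact: cvg_cst|exact: cvg_id].
  apply: cvgM; last exact: (cexp (fun s : R => s ^+ 2) s (csqr s)).
  apply: (@continuous_comp _ _ _ (fun s : R => s ^+ 2) (fun v => v `^ (-1 - alpha / 2))).
    exact: csqr.
  by apply: powR_continuous_pos; rewrite exprn_gt0.
rewrite EFinM -(integral_onem_expRN b0 b1).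
rewrite (@ge0_integral_sqr_0y _
  (fun v => v `^ (-1 - alpha / 2) * (1 - expR (- v)))); last 2 first.
- move=> v v0; apply: cvgM; first exact: powR_continuous_pos.
  by apply: (cexp id v); exact: cvg_id.
- by move=> v v0; rewrite mulr_ge0 ?powR_ge0 ?onem0// ltW.
rewrite (@ge0_integral_scale_0y _ 2^-1 g)//.
rewrite -ge0_integralZl//=.
- apply: eq_integral_pos => s s0; rewrite -EFinM; congr EFin; rewrite /g.
  rewrite (_ : expR (- (2^-1 * s) ^+ 2) = expR (- s ^+ 2 / 4)); last first.
    by congr expR; field.
  have i0 : 0 < 2^-1 :> R by [].
  have is0 : 0 < 2^-1 * s by rewrite mulr_gt0.
  rewrite -[(2^-1 * s) ^+ 2]powR_mulrn ?(ltW is0)// -powRrM.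
  have -> : 2%:R * (-1 - alpha / 2) = -1 - alpha + -1 :> R by field.
  rewrite (gt0_powRD (-1 - alpha) (-1) is0) (powR_inv1 (ltW is0)) powRM ?(ltW i0) ?(ltW s0)//.
  have : 2 `^ (-1 - alpha) * 2^-1 `^ (-1 - alpha) = 1 :> R.
    by rewrite -powRM// divff// powR1.
  move: (2 `^ _) (2^-1 `^ _) (s `^ _) (expR _) => p q r e pq.
  have -> : p * (q * r / (2^-1 * s) * (1 - e) * (2 * (2^-1 * s)) * 2^-1) =
      (p * q) * (r * (1 - e)) by field; exact: lt0r_neq0.
  by rewrite pq mul1r.
- apply/measurable_EFinP; apply: continuous_measurable_pos => s s0.
  apply: cvgM; last exact: cvg_cst.
  apply: (@continuous_comp _ _ _ (fun s : R => 2^-1 * s) g).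
    by apply: cvgM; [exact: cvg_cst|exact: cvg_id].
  by apply: cg; rewrite mulr_gt0.
- move=> s; rewrite in_itv/= andbT => s0.
  by rewrite lee_fin mulr_ge0// g0// mulr_gt0.
Qed.

(* Integrating [riesz_kernel s y] against [gauss_fun s] in both orders: over
   [y] first it is [s ^ alpha * riesz_constant], over [s] first it is the
   Gaussian cosine integral. *)
Lemma riesz_constant_Gamma :
  riesz_constant * Gamma (1 / 2 + alpha / 2) =
  Num.sqrt pi * 2 `^ (- alpha) / alpha * Gamma (1 - alpha / 2).
Proof.
pose f (z : measurableTypeR R * measurableTypeR R) : R :=
  gauss_fun z.1 * riesz_kernel z.1 z.2.
have mf : measurable_fun setT f.
  apply: measurable_funM.
    by apply: measurableT_comp => //; exact: measurable_gauss_fun.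
  apply: measurable_funM.
    apply: measurable_funB => //.
    have mcos : measurable_fun setT (@cos R).
      by apply: continuous_measurable_fun; exact: continuous_cos.
    apply: (measurableT_comp mcos).
    exact: measurable_funM.
  exact: (measurableT_comp (measurable_powR (-1 - alpha))).
have a0 : 0 < 1 / 2 + alpha / 2 by rewrite addr_gt0 ?divr_gt0.
have K0 : 0 <= riesz_constant.
  by apply: Rintegral_ge0 => y _; exact: riesz_kernel_ge0.
have := tonelli_0y mf.
(* The exponent alpha is written as 2 (1/2 + alpha/2) - 1 to match [Gamma_gauss]; this is where
   Gamma(1/2 + alpha/2) in the normalising constant comes from. *)
rewrite (@eq_integral_pos _ _ (fun s => riesz_constant%:E *
    (s `^ (2 * (1 / 2 + alpha / 2) - 1) * gauss_fun s)%:E)%E); last first.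
  move=> s s0; rewrite -EFinM.
  rewrite (@eq_integral_pos _ _ (fun y => (gauss_fun s)%:E * (riesz_kernel s y)%:E)%E)//.
  rewrite ge0_integralZl//=.
  - rewrite integral_riesz_kernel// -EFinM; congr EFin.
    by rewrite (_ : 2 * (1 / 2 + alpha / 2) - 1 = alpha); [ring|field].
  - apply/measurable_EFinP; apply: continuous_measurable_pos => y.
    exact: riesz_kernel_continuous.
  - by move=> y _; rewrite lee_fin riesz_kernel_ge0.
  - by rewrite lee_fin gauss_fun_ge0.
rewrite ge0_integralZl//=; last 2 first.
- apply/measurable_EFinP; apply: continuous_measurable_pos => s s0.
  by apply: cvgM; [exact: powR_continuous_pos|exact: continuous_gauss_fun].
- by move=> s _; rewrite lee_fin mulr_ge0 ?powR_ge0 ?gauss_fun_ge0.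
rewrite (Gamma_gauss a0).
(* In the other order the inner integral is y^(-1 - alpha) times the difference between the values
   at 0 and at y of the Gaussian cosine integral. *)
rewrite (@eq_integral_pos _ _ (fun y => (Num.sqrt pi / 2)%:E *
    (y `^ (-1 - alpha) * (1 - expR (- y ^+ 2 / 4)))%:E)%E); last first.
  move=> y y0; rewrite -EFinM.
  have ig := @integrable_gauss R.
  have igc := integrable_cos 0 y ig.
  have igd : mu.-integrable P (EFin \o (fun s => gauss_fun s - gauss_fun s * cos (y * s - 0))).
    rewrite (_ : _ \o _ = (EFin \o (@gauss_fun R)) \-
      (EFin \o (fun s => gauss_fun s * cos (y * s - 0))%R))%E//.
    by apply: integrableB; [exact: measurable_itv|exact: ig|exact: igc].
  rewrite (@eq_integral_pos _ _ (fun s => (y `^ (-1 - alpha))%:E *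
    (gauss_fun s - gauss_fun s * cos (y * s - 0))%:E)%E); last first.
    move=> s _; rewrite -EFinM /f/= /riesz_kernel subr0 (mulrC y s); congr EFin; ring.
  rewrite integralZl// -[X in (_ * X)%E]fineK; last exact: integrable_fin_num.
  rewrite -EFinM; congr EFin.
  rewrite -[X in _ * X]/(\int[mu]_(s in P) (gauss_fun s - gauss_fun s * cos (y * s - 0)))%R.
  rewrite RintegralB// -/(cos_integral (@gauss_fun R) 0 y) cos_integral_gauss.
  have -> : \int[mu]_(s in P) gauss_fun s = cos_integral (@gauss_fun R) 0 0.
    by apply: eq_Rintegral => s _; rewrite mul0r subr0 cos0 mulr1.
  by rewrite cos_integral_gauss expr0n/= oppr0 mul0r expR0; ring.
rewrite ge0_integralZl//=; last 2 first.
- apply/measurable_EFinP; apply: continuous_measurable_pos => y y0.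
  apply: cvgM; first exact: powR_continuous_pos.
  apply: cvgB; first exact: cvg_cst.
  apply: (@continuous_comp _ _ _ (fun y : R => - y ^+ 2 / 4) expR);
    last exact: continuous_expR.
  by apply: cvgM; [apply: cvgN; exact: exprn_continuous|exact: cvg_cst].
- move=> y _; rewrite lee_fin mulr_ge0 ?powR_ge0// subr_ge0 expR_le1.
  by rewrite mulNr oppr_le0 divr_ge0 ?sqr_ge0.
rewrite integral_onem_gauss -!EFinM => h.
have {}h : riesz_constant * (Gamma (1 / 2 + alpha / 2) / 2) =
    Num.sqrt pi / 2 * (2 `^ (-1 - alpha) * (Gamma (1 - alpha / 2) / (alpha / 2))).
  apply: EFin_inj; apply: h => x y _ _.
  by rewrite mulr_ge0 ?gauss_fun_ge0 ?riesz_kernel_ge0.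
apply: (@mulIf _ 2^-1); first by rewrite invr_eq0.
apply: (etrans _ (etrans h _)); first by rewrite mulrA.
rewrite (gt0_powRD (-1) (- alpha)) ?ltr0n// powR_inv1//; field.
exact: lt0r_neq0.
Qed.

(** The factor 2 stands for the equal contributions of y and -y. The nonzero Gamma factors cancel
    against those of [riesz_constant_Gamma]. *)
Lemma fraclap_const_riesz : fraclap_const alpha * (2 * riesz_constant) = 1.
Proof.
have G1 : 0 < Gamma (1 / 2 + alpha / 2) by rewrite Gamma_gt0// addr_gt0 ?divr_gt0.
have G2 : 0 < Gamma (1 - alpha / 2).
  by rewrite Gamma_gt0// subr_gt0 ltr_pdivrMr// mul1r.
have sp : 0 < Num.sqrt pi :> R by rewrite sqrtr_gt0 pi_gt0.
rewrite /fraclap_const.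
have -> : riesz_constant = Num.sqrt pi * 2 `^ (- alpha) / alpha * Gamma (1 - alpha / 2)
    / Gamma (1 / 2 + alpha / 2).
  by rewrite -riesz_constant_Gamma mulfK// lt0r_neq0.
rewrite (gt0_powRD alpha (-1)) ?ltr0n// powR_inv1//.
have : 2 `^ alpha * 2 `^ (- alpha) = 1 :> R by rewrite -gt0_powRD// subrr powRr0.
move: (2 `^ alpha) (2 `^ (- alpha)) => p q pq.
move: G1 G2; set g1 := Gamma _; set g2 := Gamma _ => G1 G2.
rewrite -[RHS]pq; field.
by rewrite !lt0r_neq0.
Qed.

End riesz_kernel.

(** * Symmetric truncation and its limit *)

Section truncated_integrals.
Context {R : realType}.
Local Notation mu := (@lebesgue_measure R).
Local Notation T := (measurableTypeR R).
Local Notation P := (`]0, +oo[%classic : set R).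

Lemma integrable_setU (A B : set T) (f : T -> \bar R) :
  measurable A -> measurable B -> [disjoint A & B] ->
  mu.-integrable A f -> mu.-integrable B f -> mu.-integrable (A `|` B) f.
Proof.
move=> mA mB AB /integrableP[mfA fA] /integrableP[mfB fB].
have mf : measurable_fun (A `|` B) f by apply/measurable_funU.
apply/integrableP; split => //; rewrite ge0_integral_setU//; last first.
  exact: measurableT_comp.
by rewrite lte_add_pinfty.
Qed.

(** Lebesgue measure is its own image under y -> -y. *)
Lemma integral_reflect (f : R -> R) (e : R) : measurable_fun setT f ->
  mu.-integrable `]e, +oo[ (EFin \o (f \o -%R)) ->
  mu.-integrable `]-oo, (- e)%R[ (EFin \o f) /\
  \int[mu]_(y in `]-oo, (- e)%R[) f y = \int[mu]_(y in `]e, +oo[) f (- y).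
Proof.
move=> mf fe; have mE : measurable_fun setT (EFin \o f : T -> \bar R).
  exact/measurable_EFinP.
have mopp : measurable_fun setT (-%R : T -> T) by exact: oppr_measurable.
have preE : (-%R : T -> T) @^-1` `]-oo, (- e)%R[%classic = `]e, +oo[%classic.
  by apply/seteqP; split => y; rewrite /= !in_itv/= ltrN2 andbT.
have mD : measurable (`]-oo, (- e)%R[%classic : set T) by exact: measurable_itv.
have fe' : mu.-integrable ((-%R : T -> T) @^-1` `]-oo, (- e)%R[%classic)
  ((EFin \o f) \o (-%R : T -> T)) by rewrite preE.
have eqm : forall A : set T, measurable A -> A `<=` `]-oo, (- e)%R[%classic ->
  mu A = pushforward mu (-%R : T -> T) A.
  by move=> A mA _; rewrite lebesgue_measureN.
split.
  have /integrableP[m1 h1] := integrable_pushforward mopp mE fe' mD.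
  apply/integrableP; split; first exact: measurable_funTS.
  by rewrite (eq_measure_integral _ eqm).
rewrite /Rintegral (eq_measure_integral _ eqm) (integral_pushforward mopp mE fe' mD).
by rewrite preE.
Qed.

(** Folding the negative side onto the positive one: the symmetric truncation becomes a one-sided
    integral, whose integrand shows the cancellation at 0. *)
Lemma integral_norm_gt (f : R -> R) (e : R) : 0 < e -> measurable_fun setT f ->
  mu.-integrable `]e, +oo[ (EFin \o f) ->
  mu.-integrable `]e, +oo[ (EFin \o (f \o -%R)) ->
  mu.-integrable [set y | e < `|y|] (EFin \o f) /\
  \int[mu]_(y in [set y | e < `|y|]) f y = \int[mu]_(y in `]e, +oo[) (f y + f (- y)).
Proof.
move=> e0 mf f1 f2.
have -> : [set y | e < `|y|] = `]e, +oo[%classic `|` `]-oo, (- e)%R[%classic.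
  apply/seteqP; split => y /=; rewrite !in_itv/= andbT lter_normr ltrNr.
    by move=> /orP.
  by move=> /orP.
have [if2 E2] := integral_reflect mf f2.
have dis : [disjoint (`]e, +oo[%classic : set T) & `]-oo, (- e)%R[%classic].
  apply/disj_setPS => y [] /=; rewrite !in_itv/= andbT; lra.
have iU : mu.-integrable (`]e, +oo[%classic `|` `]-oo, (- e)%R[%classic) (EFin \o f).
  by apply: integrable_setU => //; exact: measurable_itv.
split => //.
rewrite Rintegral_setU// E2 -RintegralD//.
Qed.

(** Reduces the principal value to integrability of the folded integrand: the missing piece over ]0,
    e] tends to 0 by continuity of the integral in its upper endpoint. *)
Lemma cvg_integral_pos (S : R -> R) : mu.-integrable P (EFin \o S) ->
  \int[mu]_(y in `]e, +oo[) S y @[e --> 0^'+] --> \int[mu]_(y in P) S y.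
Proof.
move=> iS; pose S0 := S \_ P.
have iS0 : mu.-integrable `[0, 1] (EFin \o S0).
  apply: (@integrableS _ T R mu setT) => //.
  have := (@integrable_mkcond _ T R mu P _ (measurable_itv _)).1 iS.
  by rewrite -restrict_EFin.
have h := parameterized_integral_cvg_left ltr01 iS0.
have {}h : parameterized_integral mu 0 e S0 @[e --> 0^'+] --> 0.
  exact: cvg_at_right_filter h.
rewrite -[X in _ --> X]subr0.
have : \int[mu]_(y in P) S y - parameterized_integral mu 0 e S0 @[e --> 0^'+]
    --> \int[mu]_(y in P) S y - 0.
  by apply: cvgB; [exact: cvg_cst|exact: h].
apply: cvg_trans; apply: near_eq_cvg; near=> e.
have e0 : 0 < e by near: e; exact: nbhs_right_gt.
rewrite /= /parameterized_integral -Rintegral_mkcondr.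
have -> : `[0, e]%classic `&` `]0, +oo[%classic = `]0, e]%classic :> set R.
  apply/seteqP; split => y /=; rewrite !in_itv/= andbT.
    by move=> [/andP[_ ->] ->].
  by move=> /andP[y0 ->]; rewrite y0 ltW.
by rewrite Rintegral_itvB// bnd_simp ltW.
Unshelve. all: end_near. Qed.

End truncated_integrals.

(** * The fractional Laplacian of a cosine integral *)

Section fractional_laplacian.
Context {R : realType}.
Local Notation mu := (@lebesgue_measure R).
Local Notation T := (measurableTypeR R).
Local Notation P := (`]0, +oo[%classic : set R).
Variable alpha : R.
Hypotheses (alpha_gt0 : 0 < alpha) (alpha_lt2 : alpha < 2).

Lemma integrable_powR_tail (e : R) : 0 < e ->
  mu.-integrable `]e, +oo[ (EFin \o (fun y : R => y `^ (-1 - alpha))).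
Proof.
(* Cutting off below [e] turns the tail into a function on the whole half-line that is bounded by
   e^(-1 - alpha) near 0, so that the comparison lemma applies with p = 1. *)
move=> e0; pose h (y : R) : R := y `^ (-1 - alpha) * \1_(`]e, +oo[%classic : set R) y.
have hE (y : R) : e < y -> h y = y `^ (-1 - alpha).
  by move=> ey; rewrite /h indicE mem_set/= ?in_itv/= ?ey// mulr1.
have h0 (y : R) : ~~ (e < y) -> h y = 0.
  by move=> /negP ey; rewrite /h indicE memNset/= ?in_itv/= ?andbT// mulr0.
have sub : `]e, +oo[%classic `<=` P.
  by move=> y; rewrite /= !in_itv/= !andbT; exact: lt_trans.
have ih : mu.-integrable P (EFin \o h).
  apply: (@integrable_0y_powR _ 1 alpha (e `^ (-1 - alpha)) 1) => //.
  - apply: measurable_funTS; apply: measurable_funM; first exact: measurable_powR.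
    exact: measurable_indic.
  - move=> y y0 y1; rewrite subrr powRr0 mulr1.
    have [ey|ey] := boolP (e < y); last by rewrite h0// normr0 powR_ge0.
    rewrite hE// ger0_norm ?powR_ge0//.
    rewrite (_ : -1 - alpha = - (1 + alpha)) ?powRN; last by rewrite opprD.
    rewrite lef_pV2 ?posrE ?powR_gt0// ge0_ler_powR ?nnegrE ?(ltW e0) ?(ltW y0) ?(ltW ey)//.
    by rewrite addr_ge0// ltW.
  - move=> y y1; rewrite mul1r (_ : - alpha - 1 = -1 - alpha); last by ring.
    have [ey|ey] := boolP (e < y); last by rewrite h0// normr0 powR_ge0.
    by rewrite hE// ger0_norm ?powR_ge0.
have ih' := @integrableS _ T R mu P `]e, +oo[%classic _ (measurable_itv _)
  (measurable_itv _) sub ih.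
apply: (@eq_integrable _ T _ mu `]e, +oo[%classic (measurable_itv _) _ _ _ ih') => y.
by rewrite inE/= in_itv/= andbT => ey; rewrite hE.
Qed.

Section cosine_transform.
Variables (w : R -> R) (th x : R).
(** [iw] makes the cosine integral exist and be bounded, [isw] makes it differentiable and hence its
    difference quotients measurable, and [iaw] gives the absolute convergence behind Fubini. *)
Hypotheses (mw : measurable_fun setT w)
  (iw : mu.-integrable P (EFin \o w))
  (isw : mu.-integrable P (EFin \o (fun s => s * w s)))
  (iaw : mu.-integrable P (EFin \o (fun s => s `^ alpha * w s))).

Let u := cos_integral w th.
Let I := fraclap_integrand alpha u x.
Let S (y : R) := I y + I (- y).
(** The double integrand, at (y, s). Integrated over s it is the folded difference quotient [S y];
    integrated over y it is s^alpha w(s) cos (x s - th) times twice the kernel constant. *)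
Let phi (z : T * T) : R := 2 * (w z.2 * cos (x * z.2 - th)) * riesz_kernel alpha z.2 z.1.

Let continuous_u : continuous u.
Proof.
move=> y; apply/differentiable_continuous/derivable1_diffP.
by have [] := is_derive_cos_integral th y iw isw.
Qed.

Let measurable_cos : measurable_fun setT (@cos R).
Proof. by apply: continuous_measurable_fun; exact: continuous_cos. Qed.

Let measurable_I : measurable_fun setT I.
Proof.
rewrite /I /fraclap_integrand.
under eq_fun do rewrite -powRN.
apply: measurable_funM.
  apply: measurable_funB => //; apply: continuous_measurable_fun => y.
  apply: (@continuous_comp _ _ _ (fun y => x + y) u); last exact: continuous_u.
  by apply: cvgD; [exact: cvg_cst|exact: cvg_id].
apply: (measurableT_comp (measurable_powR _)); exact: normr_measurable.
Qed.

Let I_le (y : R) :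
  `|I y| <= (2 * \int[mu]_(s in P) `|w s|) * `|y| `^ (-1 - alpha).
Proof.
rewrite /I /fraclap_integrand -powRN opprD normrM [`| _ `^ _|]ger0_norm ?powR_ge0//.
rewrite ler_wpM2r ?powR_ge0// (le_trans (ler_normB _ _))//.
by rewrite mulr_natl mulr2n lerD// cos_integral_le.
Qed.

Let integrable_I (e : R) : 0 < e ->
  mu.-integrable `]e, +oo[ (EFin \o I) /\ mu.-integrable `]e, +oo[ (EFin \o (I \o -%R)).
Proof.
move=> e0; pose M := 2 * \int[mu]_(s in P) `|w s|.
have iM : mu.-integrable `]e, +oo[ (fun y : R => M%:E * (y `^ (-1 - alpha))%:E)%E.
  by apply: integrableZl; [exact: measurable_itv|exact: integrable_powR_tail].
have M0 : 0 <= M by rewrite mulr_ge0// Rintegral_ge0.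
have IM y : `|I y| <= M * `|y| `^ (-1 - alpha) by exact: I_le.
move: M iM M0 IM => M iM M0 IM.
split; apply: (le_integrable _ _ _ iM) => //=.
- by apply: measurable_funTS; exact/measurable_EFinP.
- move=> y; rewrite in_itv/= andbT => ey; have y0 : 0 < y by exact: lt_trans ey.
  rewrite lee_fin (le_trans (IM _))// (gtr0_norm y0).
  by rewrite [leRHS]ger0_norm ?mulr_ge0 ?powR_ge0.
- apply: measurable_funTS; apply/measurable_EFinP.
  by apply: (measurableT_comp measurable_I); exact: oppr_measurable.
- move=> y; rewrite in_itv/= andbT => ey; have y0 : 0 < y by exact: lt_trans ey.
  rewrite lee_fin (le_trans (IM _))// normrN (gtr0_norm y0).
  by rewrite [leRHS]ger0_norm ?mulr_ge0 ?powR_ge0.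
Qed.

Let measurable_phi : measurable_fun setT phi.
Proof.
apply: measurable_funM.
  apply: measurable_funM => //; apply: measurable_funM.
    exact: (measurableT_comp mw).
  apply: (measurableT_comp measurable_cos).
  by apply: measurable_funB => //; exact: measurable_funM.
apply: measurable_funM.
  apply: measurable_funB => //; apply: (measurableT_comp measurable_cos).
  exact: measurable_funM.
exact: (measurableT_comp (measurable_powR (-1 - alpha))).
Qed.

(** The kernel is nonnegative, so the inner integral of the absolute value is explicit and [iaw]
    bounds the outer one. *)
Let phi_lty :
  (\int[mu]_(s in P) \int[mu]_(y in P) `|(phi (y, s))%:E| < +oo)%E.
Proof.
have K0 : 0 <= riesz_constant alpha.
  by apply: Rintegral_ge0 => y _; exact: riesz_kernel_ge0.
have ig : mu.-integrable P (fun s : R => (2 * riesz_constant alpha)%:E *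
    (s `^ alpha * w s * cos (x * s - th))%:E)%E.
  by apply: integrableZl; [exact: measurable_itv|exact: integrable_cos].
have /integrableP[_] := ig; congr (_ < _)%E; apply: eq_integral_pos => s s0.
rewrite (@eq_integral_pos _ _ (fun y : R => (`|2 * (w s * cos (x * s - th))|)%:E *
  (riesz_kernel alpha s y)%:E)%E); last first.
  move=> y _; rewrite -EFinM /phi/= normrM [`|riesz_kernel _ _ _|]ger0_norm//.
  exact: riesz_kernel_ge0.
rewrite integralZl//; last exact: integrable_riesz_kernel.
rewrite integral_riesz_kernel// -!EFinM /=; congr EFin.
rewrite !normrM (ger0_norm K0) [`|s `^ _|]ger0_norm ?powR_ge0//; ring.
Qed.

(** The identity cos (A + B) + cos (A - B) = 2 cos A cos B, read backwards under the integral; for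
    fixed y > 0 each of the terms is integrable separately. *)
Let S_phi (y : R) : 0 < y -> (\int[mu]_(s in P) (phi (y, s))%:E = (S y)%:E)%E.
Proof.
move=> y0; have i0 z := integrable_cos th z iw.
pose c := y `^ (-1 - alpha).
pose h (s : R) := w s * cos (x * s - th) - w s * cos ((x + y) * s - th)
  + (w s * cos (x * s - th) - w s * cos ((x - y) * s - th)).
have id (z : R) : mu.-integrable P (EFin \o (fun s : R =>
    w s * cos (x * s - th) - w s * cos (z * s - th))).
  rewrite (_ : _ \o _ = (EFin \o (fun s : R => w s * cos (x * s - th))%R) \-
    (EFin \o (fun s : R => w s * cos (z * s - th))%R))%E//.
  by apply: integrableB; [exact: measurable_itv|exact: i0|exact: i0].
have ih : mu.-integrable P (EFin \o h).
  rewrite (_ : _ \o _ = (EFin \o (fun s : R =>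
      w s * cos (x * s - th) - w s * cos ((x + y) * s - th))%R) \+
    (EFin \o (fun s : R => w s * cos (x * s - th) - w s * cos ((x - y) * s - th))%R))%E//.
  by apply: integrableD; [exact: measurable_itv|exact: id|exact: id].
rewrite (@eq_integral_pos _ _ (fun s : R => c%:E * (h s)%:E)%E); last first.
  move=> s s0; rewrite -EFinM; congr EFin; rewrite /phi/= /riesz_kernel /h -/c.
  rewrite (_ : (x + y) * s - th = (x * s - th) + s * y); last by ring.
  rewrite (_ : (x - y) * s - th = (x * s - th) - s * y); last by ring.
  by move: (x * s - th) => A; rewrite cosD cosB; ring.
rewrite integralZl// -[X in (_ * X)%E]fineK; last exact: integrable_fin_num.
rewrite -EFinM; congr EFin.
rewrite -[X in _ * X]/(\int[mu]_(s in P) h s)%R /h.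
rewrite RintegralD// !RintegralB// -!/(cos_integral w th _) -/u.
rewrite /S /I /fraclap_integrand normrN (gtr0_norm y0) -powRN opprD -/c; ring.
Qed.

Lemma is_fraclap_cos_integral :
  is_fraclap_real alpha (cos_integral w th) x
    (cos_integral (fun s => s `^ alpha * w s) th x).
Proof.
have fI (e : R) : 0 < e -> 
    mu.-integrable [set y | e < `|y|] (EFin \o I) /\
    \int[mu]_(y in [set y | e < `|y|]) I y = \int[mu]_(y in `]e, +oo[) S y.
  by move=> e0; have [i1 i2] := integrable_I e0; exact: integral_norm_gt.
split; first by move=> e e0; exact: (fI e e0).1.
(* Besides exchanging the integrals, Fubini yields the integrability of [S] on the half-line, which
   makes the truncated integrals converge. *)
have [iphi Ephi] := fubini_0y measurable_phi phi_lty.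
have iS : mu.-integrable P (EFin \o S).
  apply: (@eq_integrable _ T _ mu P (measurable_itv _) _ _ _ iphi) => y.
  by rewrite inE/= in_itv/= andbT => y0; rewrite S_phi.
have ES : \int[mu]_(y in P) S y =
    2 * riesz_constant alpha * cos_integral (fun s => s `^ alpha * w s) th x.
  rewrite /Rintegral -(@eq_integral_pos _ (fun y => \int[mu]_(s in P) (phi (y, s))%:E)%E);
    last exact: S_phi.
  rewrite Ephi (@eq_integral_pos _ _ (fun s : R => (2 * riesz_constant alpha)%:E *
    (s `^ alpha * w s * cos (x * s - th))%:E)%E); last first.
    move=> s s0; rewrite (@eq_integral_pos _ _ (fun y : R => (2 * (w s * cos (x * s - th)))%:E *
      (riesz_kernel alpha s y)%:E)%E); last first.
      by move=> y _; rewrite -EFinM.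
    rewrite integralZl; [|exact: measurable_itv|exact: integrable_riesz_kernel].
    by rewrite (integral_riesz_kernel alpha_gt0 alpha_lt2 s0) -!EFinM; congr (_%:E); ring.
  rewrite integralZl; [|exact: measurable_itv|exact: integrable_cos].
  rewrite -[X in (_ * X)%E]fineK; last first.
    apply: integrable_fin_num; [exact: measurable_itv|exact: integrable_cos].
  by rewrite -EFinM.
have := cvg_integral_pos iS; rewrite ES => h.
have -> : cos_integral (fun s => s `^ alpha * w s) th x = fraclap_const alpha *
    (2 * riesz_constant alpha * cos_integral (fun s => s `^ alpha * w s) th x).
  by rewrite [RHS]mulrA (fraclap_const_riesz alpha_gt0 alpha_lt2) [RHS]mul1r.
apply: cvgM; first exact: cvg_cst.
apply: cvg_trans h; apply: near_eq_cvg; near=> e.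
have e0 : 0 < e by near: e; exact: nbhs_right_gt.
by have [_ <-] := fI e e0.
Unshelve. all: end_near. Qed.

End cosine_transform.
End fractional_laplacian.

(** * Powers of [1 + ix] and finite sums *)

Lemma sum_parity (V : zmodType) (f : nat -> V) (n : nat) :
  \sum_(j < n.+1) f j =
  \sum_(l < n./2.+1) f (2 * l)%N + \sum_(l < uphalf n) f (2 * l + 1)%N.
Proof.
elim: n => [|n IHn]; first by rewrite !big_ord_recr !big_ord0 /= !add0r addr0.
rewrite big_ord_recr/= {}IHn.
have [on|en] := boolP (odd n).
  have -> : uphalf n = n./2.+1 by rewrite uphalf_half on.
  rewrite [in RHS]big_ord_recr/= addrAC; congr (_ + f _ + _).
  by rewrite mulnS mul2n -[in LHS](odd_double_half n) on.
have -> : uphalf n = n./2 by rewrite uphalf_half (negbTE en).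
rewrite [X in _ = _ + X]big_ord_recr/= addrA; congr (_ + f _).
by rewrite mul2n addn1 -[in LHS](odd_double_half n) (negbTE en).
Qed.

(* Both sides are the image of [(1 + z + X) ^+ n] by the linear form mapping
   [X ^+ k] to [b k]. *)
Lemma sum_binomial_shift (K : comNzRingType) (z : K) (b : nat -> K) (n : nat) :
  \sum_(k < n.+1) ((1 + z) ^+ (n - k) * b k) *+ 'C(n, k) =
  \sum_(j < n.+1) (z ^+ (n - j) * \sum_(k < j.+1) b k *+ 'C(j, k)) *+ 'C(n, j).
Proof.
have coefD (c : K) m k : ((c%:P + 'X) ^+ m)`_k = c ^+ (m - k) *+ 'C(m, k).
  rewrite exprDn coef_sum.
  under eq_bigr do rewrite coefMn -rmorphXn/= coefCM coefXn.
  have [km|mk] := ltnP k m.+1.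
    rewrite (bigD1 (Ordinal km))//= eqxx mulr1 big1 ?addr0// => i ik.
    by rewrite eq_sym -[_ == _]/(i == Ordinal km) (negbTE ik) mulr0 mul0rn.
  rewrite bin_small// mulr0n big1// => i _.
  by rewrite gtn_eqF ?mulr0 ?mul0rn// (leq_trans (ltn_ord i)).
have E k : (1 + z) ^+ (n - k) *+ 'C(n, k) =
    \sum_(j < n.+1) (z ^+ (n - j) *+ 'C(j, k)) *+ 'C(n, j).
  rewrite -coefD polyCD [1%:P + _]addrC -addrA exprDn coef_sum.
  apply: eq_bigr => j _.
  by rewrite coefMn -rmorphXn/= coefCM coefD expr1n mulrnAr mulr1.
transitivity (\sum_(k < n.+1) \sum_(j < n.+1)
    ((z ^+ (n - j) *+ 'C(j, k)) *+ 'C(n, j)) * b k).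
  by apply: eq_bigr => k _; rewrite -mulr_suml -E mulrnAl.
rewrite exchange_big/=; apply: eq_bigr => j _.
rewrite [in RHS](big_ord_widen n.+1 (fun k => b k *+ 'C(j, k)))//=.
rewrite [in RHS]big_mkcond/= mulr_sumr -sumrMnl; apply: eq_bigr => k _.
case: ltnP => [_|jk]; last by rewrite bin_small// mulr0n !mul0rn mul0r mulr0 mul0rn.
by rewrite mulrnAl [in LHS]mulrnAl mulrnAr.
Qed.

Section cis.
Context {R : realType}.
Local Open Scope complex_scope.

Definition cis (t : R) : R[i] := cos t +i* sin t.

Lemma cisD s t : cis (s + t) = cis s * cis t.
Proof.
by rewrite /cis cosD sinD; apply/eqP; rewrite eq_complex/= !eqxx/= addrC.
Qed.

Lemma cis0 : cis 0 = 1.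
Proof. by rewrite /cis cos0 sin0. Qed.

Lemma cisMn t n : cis (t *+ n) = cis t ^+ n.
Proof.
by elim: n => [|n IHn]; rewrite ?mulr0n ?cis0// mulrS cisD IHn exprS.
Qed.

Lemma cisNpihalf : cis (- (pi / 2)) = - 'i%C.
Proof.
by rewrite /cis cosN sinN cos_pihalf sin_pihalf; apply/eqP; rewrite eq_complex/= oppr0 !eqxx.
Qed.

(* The principal determination of [(1 + ix) ^ (- a)]. *)
Definition onem_ix_powN (x a : R) : R[i] :=
  ((1 + x ^+ 2) `^ (- (a / 2)))%:C * cis (- (a * atan x)).

Local Notation W := onem_ix_powN.

Lemma onem_ix_powND x a b : W x (a + b) = W x a * W x b.
Proof.
rewrite /W mulrDl !opprD [(a + b) * _]mulrDl opprD cisD powRD; last first.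
  by rewrite lt0r_neq0 ?implybT// ltr_pwDl// sqr_ge0.
by rewrite rmorphM/= mulrACA.
Qed.

Lemma onem_ix_powN0 x : W x 0 = 1.
Proof. by rewrite /W mul0r oppr0 powRr0 mul0r oppr0 cis0 mulr1. Qed.

(** The modulus of 1 + ix is sqrt(1 + x^2) and its argument is atan x. This anchors the polar
    definition to 1 + ix; integer powers follow by additivity in the exponent. *)
Lemma onem_ix_powNN1 x : W x (-1) = 'i%C * x%:C + 1.
Proof.
have D0 : 0 < 1 + x ^+ 2 by rewrite ltr_pwDl// sqr_ge0.
have s0 : 0 < Num.sqrt (1 + x ^+ 2) by rewrite sqrtr_gt0.
rewrite /W mulNr opprK mul1r powR12_sqrt ?(ltW D0)// mulN1r opprK /cis.
have -> : sin (atan x) = x * cos (atan x).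
  have c0 : cos (atan x) != 0 by rewrite cos_atan invr_eq0 lt0r_neq0.
  by have := atanK x; rewrite /tan => /(congr1 ( *%R^~ (cos (atan x)))); rewrite divfK.
rewrite cos_atan; apply/eqP; rewrite eq_complex/=; apply/andP; split; apply/eqP.
  by field; rewrite lt0r_neq0.
by field; rewrite lt0r_neq0.
Qed.

Lemma onem_ix_powNM x n : W x (- n%:R) = ('i%C * x%:C + 1) ^+ n.
Proof.
elim: n => [|n IHn]; first by rewrite oppr0 onem_ix_powN0 expr0.
by rewrite -natr1 opprD onem_ix_powND onem_ix_powNN1 IHn exprSr.
Qed.

End cis.

(** * Linearity of the fractional Laplacian *)

Section linearity.
Context {R : realType}.
Local Notation mu := (@lebesgue_measure R).
Variables (alpha x : R).

Lemma measurable_norm_gt (e : R) :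
  measurable ([set y | e < `|y|] : set (measurableTypeR R)).
Proof.
have -> : [set y : R | e < `|y|] = (Num.norm : R -> R) @^-1` `]e, +oo[%classic.
  by apply/seteqP; split => y; rewrite /= in_itv/= andbT.
rewrite -[X in measurable X]setTI.
by apply: normr_measurable => //; exact: measurable_itv.
Qed.

Lemma is_fraclap_real_scale (c : R) (u : R -> R) (v : R) :
  is_fraclap_real alpha u x v -> is_fraclap_real alpha (fun t => c * u t) x (c * v).
Proof.
have E y : fraclap_integrand alpha (fun t => c * u t) x y =
    c * fraclap_integrand alpha u x y.
  by rewrite /fraclap_integrand -mulrBr mulrA.
have mD := measurable_norm_gt.
move=> [iu ulim]; split.
  move=> e e0; rewrite (funext E).
  rewrite (_ : _ \o _ = fun y => (c%:E * (EFin \o fraclap_integrand alpha u x) y)%E)//.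
  by apply: integrableZl; [exact: mD|exact: iu].
have : c * (fraclap_const alpha *
       (\int[mu]_(y in [set y | e < `|y|]) fraclap_integrand alpha u x y))
     @[e --> 0^'+] --> c * v by apply: cvgM; [exact: cvg_cst|exact: ulim].
apply: cvg_trans; apply: near_eq_cvg; near=> e.
have e0 : 0 < e by near: e; exact: nbhs_right_gt.
rewrite mulrCA -(RintegralZl c (mD e) (iu e e0)).
by congr (_ * _); apply: eq_Rintegral => y _; rewrite E.
Unshelve. all: end_near. Qed.

Lemma is_fraclap_real_add (u1 u2 : R -> R) (v1 v2 : R) :
  is_fraclap_real alpha u1 x v1 -> is_fraclap_real alpha u2 x v2 ->
  is_fraclap_real alpha (fun t => u1 t + u2 t) x (v1 + v2).
Proof.
have E y : fraclap_integrand alpha (fun t => u1 t + u2 t) x y =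
    fraclap_integrand alpha u1 x y + fraclap_integrand alpha u2 x y.
  by rewrite /fraclap_integrand -mulrDl; congr (_ / _); ring.
have mD := measurable_norm_gt.
move=> [iu1 lim1] [iu2 lim2]; split.
  move=> e e0; rewrite (funext E).
  rewrite (_ : _ \o _ = (EFin \o fraclap_integrand alpha u1 x) \+
    (EFin \o fraclap_integrand alpha u2 x))%E//.
  by apply: integrableD; [exact: mD|exact: iu1|exact: iu2].
have : fraclap_const alpha *
       (\int[mu]_(y in [set y | e < `|y|]) fraclap_integrand alpha u1 x y) +
     fraclap_const alpha *
       (\int[mu]_(y in [set y | e < `|y|]) fraclap_integrand alpha u2 x y)
     @[e --> 0^'+] --> v1 + v2 by apply: cvgD; [exact: lim1|exact: lim2].
apply: cvg_trans; apply: near_eq_cvg; near=> e.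
have e0 : 0 < e by near: e; exact: nbhs_right_gt.
rewrite /= -mulrDr -(RintegralD (mD e) (iu1 e e0) (iu2 e e0)).
by congr (_ * _); apply: eq_Rintegral => y _; rewrite E.
Unshelve. all: end_near. Qed.

Lemma is_fraclap_real_0 : is_fraclap_real alpha (fun=> 0) x 0.
Proof.
have E y : fraclap_integrand alpha (fun=> 0) x y = 0.
  by rewrite /fraclap_integrand subrr mul0r.
split=> [e e0|].
  by rewrite (funext E); exact: integrable0.
apply: cvg_near_cst; apply: nearW => e.
by under eq_Rintegral do rewrite E; rewrite /Rintegral integral0 mulr0.
Qed.

Lemma is_fraclap_real_sum n (c : nat -> R) (u : nat -> R -> R) (v : nat -> R) :
  (forall k, is_fraclap_real alpha (u k) x (v k)) ->
  is_fraclap_real alpha (fun t => \sum_(k < n) c k * u k t) x (\sum_(k < n) c k * v k).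
Proof.
move=> uv; elim: n => [|n IHn].
  under eq_fun do rewrite big_ord0.
  by rewrite big_ord0; exact: is_fraclap_real_0.
under eq_fun do rewrite big_ord_recr.
rewrite big_ord_recr; apply: is_fraclap_real_add => //.
exact: is_fraclap_real_scale.
Qed.

Lemma is_fraclap_realC (u : R -> R) (v : R) : is_fraclap_real alpha u x v ->
  is_fraclap alpha (fun t => (u t)%:C) x v%:C.
Proof. by move=> uv; split => //=; exact: is_fraclap_real_0. Qed.

End linearity.

(** * Pochhammer symbols and terminating hypergeometric sums *)

Section hypergeometric.
Context {R : realType}.

Lemma pochhammerS (w : R) k : pochhammer w k.+1 = pochhammer w k * (w + k%:R).
Proof. by rewrite /pochhammer big_ord_recr. Qed.

Lemma pochhammer0 (w : R) : pochhammer w 0 = 1.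
Proof. by rewrite /pochhammer big_ord0. Qed.

Lemma Gamma_pochhammer (w : R) k : 0 < w -> Gamma (w + k%:R) = Gamma w * pochhammer w k.
Proof.
move=> w0; elim: k => [|k IHk]; first by rewrite addr0 pochhammer0 mulr1.
rewrite -natr1 addrA GammaS ?IHk ?pochhammerS; first by ring.
by rewrite ltr_pwDl.
Qed.

Lemma pochhammer_Nnat m k : pochhammer (- m%:R : R) k = (-1) ^+ k * (m ^_ k)%:R.
Proof.
elim: k => [|k IHk]; first by rewrite pochhammer0 expr0 mul1r.
rewrite pochhammerS IHk ffactnSr natrM exprS.
(* For k > m natural subtraction truncates [m - k], but both sides vanish through the falling
   factorial. *)
have [km|mk] := leqP k m; first by rewrite natrB//; ring.
by rewrite ffact_small// !(mul0r, mulr0).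
Qed.

(** Because (-m)_k / k! = (-1)^k C(m, k), the terminating series is a binomial transform, the form
    produced by [sum_binomial_shift]. *)
Lemma hyp2F1_binomial m (b c z : R) :
  hyp2F1 (- m%:R) b c z =
  \sum_(k < m.+1) ((- z) ^+ k * (pochhammer b k / pochhammer c k)) *+ 'C(m, k).
Proof.
rewrite hyp2F1_Nnat; apply: eq_bigr => k _.
rewrite /hyp2F1_term pochhammer_Nnat -bin_ffact natrM -[RHS]mulr_natr (exprNn z).
have k0 : k`!%:R != 0 :> R by rewrite pnatr_eq0 -lt0n fact_gt0.
move: (pochhammer c k)^-1 => d; field.
by rewrite k0.
Qed.

End hypergeometric.

(** * The functions mu_n and their images *)

Section Malmquist_Takenaka.
Context {R : realType}.
Local Open Scope complex_scope.
Local Notation W := onem_ix_powN.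
Local Notation mu := (@lebesgue_measure R).
Local Notation P := (`]0, +oo[%classic : set R).
Implicit Types (x : R) (n : nat).

(** It is [W x (-1)], with inverse [W x 1]. *)
Lemma onem_ix_neq0 x : 'i%C * x%:C + 1 != 0 :> R[i].
Proof.
apply/eqP => h; have := onem_ix_powND x (-1) 1.
rewrite addNr onem_ix_powN0 onem_ix_powNN1 h mul0r => /eqP.
by rewrite oner_eq0.
Qed.

Lemma onem_ix_powN_nat x n : W x n%:R = ('i%C * x%:C + 1) ^- n.
Proof.
have := onem_ix_powND x n%:R (- n%:R).
rewrite subrr onem_ix_powN0 onem_ix_powNM => h.
apply: (mulIf (expf_neq0 n (onem_ix_neq0 x))).
by rewrite -h mulVf// expf_neq0// onem_ix_neq0.
Qed.

Lemma mu_nat n x :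
  mu_ n%:Z x = ('i%C * x%:C - 1) ^+ n / ('i%C * x%:C + 1) ^+ n.+1.
Proof.
by rewrite /mu_; have -> : n%:Z + 1 = n.+1%:Z by rewrite intS addrC.
Qed.

Lemma mu_sum n x :
  mu_ n%:Z x = \sum_(k < n.+1) (('C(n, k)%:R * (-2) ^+ k)%:C * W x k.+1%:R).
Proof.
rewrite mu_nat.
have -> : 'i%C * x%:C - 1 = ('i%C * x%:C + 1) + (-2)%:C :> R[i].
  by rewrite rmorphN/= rmorphMn/=; ring.
rewrite exprDn mulr_suml; apply: eq_bigr => k _.
rewrite onem_ix_powN_nat rmorphM rmorphXn/= rmorph_nat.
have u0 := onem_ix_neq0 x.
have -> : ('i%C * x%:C + 1) ^+ n.+1 =
    ('i%C * x%:C + 1) ^+ (n - k) * ('i%C * x%:C + 1) ^+ k.+1 :> R[i].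
  by rewrite -exprD addnS subnK// -ltnS.
rewrite -mulr_natr; field.
by rewrite !expf_neq0.
Qed.

(** Conjugation sends ix - 1 to - (ix + 1) and ix + 1 to - (ix - 1). It thus swaps numerator and
    denominator, and the n and n + 1 signs leave a single minus. *)
Lemma mu_conj n x : mu_ (- n%:Z - 1) x = - (mu_ n%:Z x)^*%C.
Proof.
have -> : (mu_ n%:Z x)^*%C =
    (- ('i%C * x%:C + 1)) ^+ n / (- ('i%C * x%:C - 1)) ^+ n.+1 :> R[i].
  rewrite mu_nat rmorphM fmorphV !rmorphXn; congr (_ ^+ _ / _ ^+ _).
    by apply/eqP; rewrite eq_complex/=; apply/andP; split; apply/eqP; ring.
  by apply/eqP; rewrite eq_complex/=; apply/andP; split; apply/eqP; ring.
rewrite /mu_; have -> : - n%:Z - 1 = - n.+1%:Z by rewrite intS opprD addrC.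
have -> : - n.+1%:Z + 1 = - n%:Z by rewrite intS opprD addrAC addNr add0r.
rewrite -!exprnN invrK.
move: ('i%C * x%:C + 1) ('i%C * x%:C - 1) => p m.
have -> : (- m) ^+ n.+1 = - ((-1) ^+ n * m ^+ n.+1).
  by rewrite (exprNn m) (exprS (-1)) mulN1r mulNr.
rewrite (exprNn p) invrN mulrN opprK invfM mulrACA divff ?mul1r ?signr_eq0//.
by rewrite mulrC.
Qed.

Lemma CC_even_Re n x : CC_even n x = (complex.Re (mu_ n%:Z x))%:C.
Proof. by rewrite /CC_even mu_conj opprK ReJ_add. Qed.

Lemma SC_odd_Im n x : SC_odd n x = (- complex.Im (mu_ n%:Z x))%:C.
Proof.
rewrite /SC_odd mu_conj rmorphN/=; congr (- _).
have i0 : 'i%C != 0 :> R[i] by rewrite eq_complex/= oner_eq0 andbF.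
by rewrite subcJ; field.
Qed.

Lemma Re_sum n (z : nat -> R[i]) :
  complex.Re (\sum_(k < n) z k) = \sum_(k < n) complex.Re (z k).
Proof.
elim: n => [|n IHn]; first by rewrite !big_ord0.
by rewrite !big_ord_recr/= -IHn; case: (\sum_(k < n) z k) (z n) => [a b] [].
Qed.

Lemma Im_sum n (z : nat -> R[i]) :
  complex.Im (\sum_(k < n) z k) = \sum_(k < n) complex.Im (z k).
Proof.
elim: n => [|n IHn]; first by rewrite !big_ord0.
by rewrite !big_ord_recr/= -IHn; case: (\sum_(k < n) z k) (z n) => [a b] [].
Qed.

Lemma Re_scale (c : R) (z : R[i]) : complex.Re (c%:C * z) = c * complex.Re z.
Proof. by case: z => a b /=; ring. Qed.

Lemma Im_scale (c : R) (z : R[i]) : complex.Im (c%:C * z) = c * complex.Im z.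
Proof. by case: z => a b /=; ring. Qed.

Lemma cos_integral_Re (a x : R) : 0 < a ->
  cos_integral (gamma_weight a) 0 x = Gamma a * complex.Re (W x a).
Proof.
by move=> a0; rewrite cos_integral_gamma// subr0 Re_scale/= cosN mulrA.
Qed.

Lemma cos_integral_Im (a x : R) : 0 < a ->
  cos_integral (gamma_weight a) (pi / 2) x = Gamma a * - complex.Im (W x a).
Proof.
move=> a0; rewrite cos_integral_gamma// cosBpihalf Im_scale/= sinN; ring.
Qed.

(** Coefficients with respect to the cosine integrals rather than to the powers of 1 + ix: dividing
    by Gamma(k + 1) compensates the factor in [cos_integral_Re] and [cos_integral_Im]. *)
Definition mu_coef n k : R := 'C(n, k)%:R * (-2) ^+ k / Gamma k.+1%:R.

Lemma Re_mu n x : complex.Re (mu_ n%:Z x) =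
  \sum_(k < n.+1) mu_coef n k * cos_integral (gamma_weight k.+1%:R) 0 x.
Proof.
rewrite mu_sum (Re_sum _ (fun k => ('C(n, k)%:R * (-2) ^+ k)%:C * W x k.+1%:R)).
apply: eq_bigr => k _.
rewrite Re_scale cos_integral_Re ?ltr0n// /mu_coef.
by rewrite mulrA divfK// lt0r_neq0// Gamma_gt0 ?ltr0n.
Qed.

Lemma Im_mu n x : - complex.Im (mu_ n%:Z x) =
  \sum_(k < n.+1) mu_coef n k * cos_integral (gamma_weight k.+1%:R) (pi / 2) x.
Proof.
rewrite mu_sum (Im_sum _ (fun k => ('C(n, k)%:R * (-2) ^+ k)%:C * W x k.+1%:R)).
rewrite -sumrN; apply: eq_bigr => k _.
rewrite Im_scale cos_integral_Im ?ltr0n// /mu_coef.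
by rewrite mulrA divfK ?mulrN// lt0r_neq0// Gamma_gt0 ?ltr0n.
Qed.

Section fraclap.
Variable alpha : R.
Hypotheses (alpha_gt0 : 0 < alpha) (alpha_lt2 : alpha < 2).

(** Multiplying the weight by s^alpha only raises its parameter by alpha, and multiplying by s
    raises it by 1, so every integrability condition is that of a Gamma integral with positive
    parameter. *)
Lemma is_fraclap_gamma_weight k th x :
  is_fraclap_real alpha (cos_integral (gamma_weight k.+1%:R) th) x
    (cos_integral (gamma_weight (k.+1%:R + alpha)) th x).
Proof.
have k0 : 0 < k.+1%:R :> R by rewrite ltr0n.
have aE (s : R) : 0 < s ->
    s `^ alpha * gamma_weight k.+1%:R s = gamma_weight (k.+1%:R + alpha) s.
  move=> s0; rewrite /gamma_weight mulrA -gt0_powRD//; congr (_ `^ _ * _); ring.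
rewrite -(eq_cos_integral th x aE); apply: is_fraclap_cos_integral => //.
- apply: measurable_funM; first exact: measurable_powR.
  by apply: continuous_measurable_fun; exact: continuous_expRN.
- exact: integrable_gamma_weight.
- have iw := integrable_gamma_weight (addr_gt0 k0 ltr01).
  apply: (@eq_integrable _ (measurableTypeR R) _ mu P (measurable_itv _) _ _ _ iw).
  by move=> s; rewrite inE/= in_itv/= andbT => s0; rewrite gamma_weightS.
- have iw := integrable_gamma_weight (addr_gt0 k0 alpha_gt0).
  apply: (@eq_integrable _ (measurableTypeR R) _ mu P (measurable_itv _) _ _ _ iw).
  by move=> s; rewrite inE/= in_itv/= andbT => s0; rewrite aE.
Qed.

(** The image of mu_n, term by term: Gamma(k + 1) has become Gamma(k + 1 + alpha). Its real part and
    negated imaginary part are the two values sought. *)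
Definition fraclap_mu n x : R[i] :=
  \sum_(k < n.+1) (mu_coef n k * Gamma (k.+1%:R + alpha))%:C * W x (k.+1%:R + alpha).

(** Factoring out the most negative power leaves (1 + ix)^(n - k), and Gamma(k + 1 + alpha) /
    Gamma(k + 1) is Gamma(1 + alpha) (1 + alpha)_k / (1)_k. Re-expanding in powers of ix gathers
    these ratios, with the (-2)^k of mu_n, into 2F1 at 2. *)
Lemma fraclap_mu_sum n x : fraclap_mu n x =
  (Gamma (1 + alpha))%:C * W x (n%:R + 1 + alpha) *
  \sum_(j < n.+1)
    (('i%C * x%:C) ^+ (n - j) * (hyp2F1 (- j%:R) (1 + alpha) 1 2)%:C) *+ 'C(n, j).
Proof.
pose b k : R := (-2) ^+ k * (pochhammer (1 + alpha) k / pochhammer 1 k).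
have a1 : 0 < 1 + alpha by rewrite addr_gt0.
transitivity ((Gamma (1 + alpha))%:C * W x (n%:R + 1 + alpha) *
    \sum_(k < n.+1) ((1 + 'i%C * x%:C) ^+ (n - k) * (b k)%:C) *+ 'C(n, k)).
  rewrite mulr_sumr; apply: eq_bigr => k _.
  have kn : (k <= n)%N by rewrite -ltnS.
  have -> : k.+1%:R + alpha = (n%:R + 1 + alpha) + - (n - k)%:R :> R.
    by rewrite natrB// -natr1; ring.
  rewrite onem_ix_powND onem_ix_powNM [1 + 'i%C * _]addrC.
  have -> : n%:R + 1 + alpha + - (n - k)%:R = (1 + alpha) + k%:R :> R.
    by rewrite natrB//; ring.
  have -> : mu_coef n k * Gamma (1 + alpha + k%:R) = Gamma (1 + alpha) * b k *+ 'C(n, k).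
    rewrite /mu_coef Gamma_pochhammer// -[k.+1%:R]natr1 [k%:R + 1]addrC.
    by rewrite Gamma_pochhammer// Gamma1 mul1r /b -mulr_natr; ring.
  rewrite rmorphMn/= rmorphM/= mulrnAr mulrnAl; congr (_ *+ _); ring.
congr (_ * _); rewrite (sum_binomial_shift _ (fun k => (b k)%:C)).
apply: eq_bigr => j _; congr (_ * _ *+ _).
rewrite hyp2F1_binomial rmorph_sum/=.
by apply: eq_bigr => k _; rewrite rmorphMn.
Qed.

Definition hyp_even n x : R := \sum_(l < n./2.+1)
  (-1) ^+ l * 'C(n, 2 * l)%:R * x ^+ (n - 2 * l) * hyp2F1 (- (2 * l)%:R) (1 + alpha) 1 2.

Definition hyp_odd n x : R := \sum_(l < uphalf n)
  (-1) ^+ l * 'C(n, 2 * l + 1)%:R * x ^+ (n - 2 * l - 1)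
    * hyp2F1 (- (2 * l)%:R - 1) (1 + alpha) 1 2.

Lemma sum_parity_i n x :
  \sum_(j < n.+1) ((- 'i%C) ^+ j *
      (x ^+ (n - j) * hyp2F1 (- j%:R) (1 + alpha) 1 2)%:C) *+ 'C(n, j) =
  (hyp_even n x)%:C - 'i%C * (hyp_odd n x)%:C.
Proof.
rewrite (sum_parity (fun j => ((- 'i%C) ^+ j *
  (x ^+ (n - j) * hyp2F1 (- j%:R) (1 + alpha) 1 2)%:C) *+ 'C(n, j))).
have i2 l : (- 'i%C) ^+ (2 * l) = ((-1) ^+ l)%:C :> R[i].
  by rewrite exprM sqrrN sqr_i rmorphXn/= rmorphN1.
rewrite /hyp_even /hyp_odd !rmorph_sum/= mulr_sumr -sumrN; congr (_ + _).
  apply: eq_bigr => l _; rewrite i2 -mulr_natr -[('C(_, _))%:R in LHS](rmorph_nat (real_complex R)).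
  by rewrite /= -!rmorphM/=; congr (_%:C); ring.
apply: eq_bigr => l _; rewrite exprD i2 expr1 natrD opprD subnDA.
rewrite -mulr_natr -[('C(_, _))%:R in LHS](rmorph_nat (real_complex R)) /=.
rewrite !rmorphM/=; ring.
Qed.

(** As arccot x = pi/2 - atan x, the argument - (n + 1 + alpha) atan x equals phi - (n + 1) pi/2,
    which contributes (-i)^(n + 1). One factor -i stays in front, and (-i)^n (ix)^(n - j) = (-i)^j
    x^(n - j) makes each summand real or purely imaginary according to the parity of j. *)
Lemma fraclap_muE n x :
  let phi := (n%:R + 1 + alpha) * arccot x - pi * alpha / 2 in
  fraclap_mu n x =
  (Gamma (1 + alpha) / (1 + x ^+ 2) `^ ((n%:R + 1 + alpha) / 2))%:C *
  (- 'i%C * cis phi * ((hyp_even n x)%:C - 'i%C * (hyp_odd n x)%:C)).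
Proof.
move=> phi; rewrite fraclap_mu_sum -sum_parity_i /onem_ix_powN.
have -> : - ((n%:R + 1 + alpha) * atan x) = phi + (- (pi / 2)) *+ n.+1.
  by rewrite /phi arccotE -mulr_natr -natr1; field.
rewrite cisD cisMn cisNpihalf powRN rmorphM/= -!mulrA; congr (_ * (_ * _)).
rewrite [RHS]mulrCA; congr (_ * _).
rewrite exprS -mulrA; congr (_ * _); rewrite mulr_sumr; apply: eq_bigr => j _.
rewrite mulrnAr; congr (_ *+ _).
have jn : (j <= n)%N by rewrite -ltnS.
rewrite -{1}(subnKC jn) exprD -mulrA; congr (_ * _).
rewrite mulrA -exprMn mulrA.
have -> : - 'i%C * 'i%C = 1 :> R[i] by rewrite mulNr -expr2 sqr_i opprK.
by rewrite mul1r rmorphM rmorphXn.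
Qed.

Lemma Re_fraclap_mu n x : complex.Re (fraclap_mu n x) =
  \sum_(k < n.+1) mu_coef n k * cos_integral (gamma_weight (k.+1%:R + alpha)) 0 x.
Proof.
rewrite /fraclap_mu (Re_sum _ (fun k => (mu_coef n k * Gamma (k.+1%:R + alpha))%:C *
  W x (k.+1%:R + alpha))).
apply: eq_bigr => k _; rewrite Re_scale cos_integral_Re ?mulrA//.
by rewrite addr_gt0 ?ltr0n.
Qed.

Lemma Im_fraclap_mu n x : - complex.Im (fraclap_mu n x) =
  \sum_(k < n.+1) mu_coef n k * cos_integral (gamma_weight (k.+1%:R + alpha)) (pi / 2) x.
Proof.
rewrite /fraclap_mu (Im_sum _ (fun k => (mu_coef n k * Gamma (k.+1%:R + alpha))%:C *
  W x (k.+1%:R + alpha))) -sumrN.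
apply: eq_bigr => k _; rewrite Im_scale cos_integral_Im ?mulrN ?mulrA//.
by rewrite addr_gt0 ?ltr0n.
Qed.

Lemma is_fraclap_CC_even n x :
  is_fraclap alpha (CC_even n) x (complex.Re (fraclap_mu n x))%:C.
Proof.
rewrite (_ : CC_even n = fun t => (\sum_(k < n.+1)
    mu_coef n k * cos_integral (gamma_weight k.+1%:R) 0 t)%:C); last first.
  by apply/funext => t; rewrite CC_even_Re Re_mu.
rewrite Re_fraclap_mu; apply: is_fraclap_realC.
apply: (is_fraclap_real_sum n.+1 (mu_coef n)
  (u := fun k => cos_integral (gamma_weight k.+1%:R) 0)
  (v := fun k => cos_integral (gamma_weight (k.+1%:R + alpha)) 0 x)) => k.
exact: is_fraclap_gamma_weight.
Qed.

Lemma is_fraclap_SC_odd n x :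
  is_fraclap alpha (SC_odd n) x (- complex.Im (fraclap_mu n x))%:C.
Proof.
rewrite (_ : SC_odd n = fun t => (\sum_(k < n.+1)
    mu_coef n k * cos_integral (gamma_weight k.+1%:R) (pi / 2) t)%:C); last first.
  by apply/funext => t; rewrite SC_odd_Im Im_mu.
rewrite Im_fraclap_mu; apply: is_fraclap_realC.
apply: (is_fraclap_real_sum n.+1 (mu_coef n)
  (u := fun k => cos_integral (gamma_weight k.+1%:R) (pi / 2))
  (v := fun k => cos_integral (gamma_weight (k.+1%:R + alpha)) (pi / 2) x)) => k.
exact: is_fraclap_gamma_weight.
Qed.

End fraclap.
End Malmquist_Takenaka.

(* \lfloor n/2 \rfloor + 1 = n./2.+1 terms and
   \lfloor (n-1)/2 \rfloor + 1 = uphalf n terms respectively. *)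
Theorem proposition3p3 (R : realType) (alpha : R)
    (alpha_gt0 : 0 < alpha) (alpha_lt2 : alpha < 2) (n : nat) (x : R) :
  is_fraclap alpha (CC_even n) x
    (Gamma (1 + alpha) / (1 + x ^+ 2) `^ ((n%:R + 1 + alpha) / 2)
       * sin ((n%:R + 1 + alpha) * arccot x - pi * alpha / 2)
       * (\sum_(l < n./2.+1)
            (-1) ^+ l * 'C(n, 2 * l)%:R * x ^+ (n - 2 * l)
              * hyp2F1 (- (2 * l)%:R) (1 + alpha) 1 2)
     - Gamma (1 + alpha) / (1 + x ^+ 2) `^ ((n%:R + 1 + alpha) / 2)
       * cos ((n%:R + 1 + alpha) * arccot x - pi * alpha / 2)
       * (\sum_(l < uphalf n)
            (-1) ^+ l * 'C(n, 2 * l + 1)%:R * x ^+ (n - 2 * l - 1)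
              * hyp2F1 (- (2 * l)%:R - 1) (1 + alpha) 1 2))%:C
  /\
  is_fraclap alpha (SC_odd n) x
    (Gamma (1 + alpha) / (1 + x ^+ 2) `^ ((n%:R + 1 + alpha) / 2)
       * cos ((n%:R + 1 + alpha) * arccot x - pi * alpha / 2)
       * (\sum_(l < n./2.+1)
            (-1) ^+ l * 'C(n, 2 * l)%:R * x ^+ (n - 2 * l)
              * hyp2F1 (- (2 * l)%:R) (1 + alpha) 1 2)
     + Gamma (1 + alpha) / (1 + x ^+ 2) `^ ((n%:R + 1 + alpha) / 2)
       * sin ((n%:R + 1 + alpha) * arccot x - pi * alpha / 2)
       * (\sum_(l < uphalf n)
            (-1) ^+ l * 'C(n, 2 * l + 1)%:R * x ^+ (n - 2 * l - 1)
              * hyp2F1 (- (2 * l)%:R - 1) (1 + alpha) 1 2))%:C.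
Proof.
have := is_fraclap_CC_even alpha_gt0 alpha_lt2 n x.
have := is_fraclap_SC_odd alpha_gt0 alpha_lt2 n x.
rewrite (fraclap_muE alpha_gt0) Re_scale Im_scale.
set c := Gamma (1 + alpha) / _; set phi := _ - pi * alpha / 2.
rewrite -/(hyp_even alpha n x) -/(hyp_odd alpha n x).
(* It remains to read off -i (cos phi + i sin phi)(A - i B) = (A sin phi - B cos phi) - i (A cos phi
   + B sin phi). *)
move: (hyp_even alpha n x) (hyp_odd alpha n x) => A B.
rewrite (_ : - _ = c * cos phi * A + c * sin phi * B); last first.
  by rewrite /cis/=; ring.
rewrite (_ : c * complex.Re _ = c * sin phi * A - c * cos phi * B)//.
by rewrite /cis/=; ring.
Qed.
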